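(* Let $(\mathcal{A},\phi)$ be a noncommutative probability space, let $q$ and $p$ be positive integers, and let $x_1,\dots,x_q\in\mathcal{A}$ be freely independent noncommutative random variables. Let $X\in \mathrm{Mat}_p(\mathbb{C}\langle x_1,\dots,x_q\rangle)\subset \mathrm{Mat}_p(\mathcal{A})$ be a matrix. If the laws of $x_1,\dots,x_q$ are algebraic, then so is the law of $X$, where $X$ is regarded as a noncommutative random variable in $(\mathrm{Mat}_p(\mathcal{A}),\phi_p)$ with $\phi_p(M)=\frac1p\sum_{i=1}^p\phi(M(i,i))$.
   Context: All algebras are unital, associative, and have a scalar field containing $\mathbb{C}$. A state on an algebra $\mathcal{A}$ is a $\mathbb{C}$-linear functional $\phi:\mathcal{A}\to\mathbb{C}$ with $\phi(1_{\mathcal{A}})=1$ (no positivity is imposed). A noncommutative probability space is a pair $(\mathcal{A},\phi)$ of an algebra and a state on it; elements of $\mathcal{A}$ are called noncommutative random variables. $\mathbb{C}\langle x_1,\dots,x_q\rangle\subset\mathcal{A}$ is the subring consisting of all finite $\mathbb{C}$-linear combinations of monomials in $x_1,\dots,x_q$, including the empty monomial $1_{\mathcal{A}}$. Free independence: subalgebras $\mathcal{A}_1,\dots,\mathcal{A}_q\subset\mathcal{A}$, each containing $1_{\mathcal A}$, are freely independent if for every $k\ge1$, all $i_1,\dots,i_k\in\{1,\dots,q\}$ with $i_1\ne i_2,\ i_2\neq i_3,\dots,i_{k-1}\ne i_k$, and all $y_1\in\mathcal{A}_{i_1},\dots,y_k\in\mathcal{A}_{i_k}$ with $\phi(y_1)=\cdots=\phi(y_k)=0$,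 one has $\phi(y_1\cdots y_k)=0$. Elements $x_1,\dots,x_q$ are freely independent if $\mathbb{C}\langle x_1\rangle,\dots,\mathbb{C}\langle x_q\rangle$ are. The law of $x\in\mathcal{A}$ is the linear functional $\mu_x:\mathbb{C}\langle\mathbf{X}\rangle\to\mathbb{C}$ on the one-variable polynomial algebra with $\mu_x(\mathbf{X}^n)=\phi(x^n)$ for $n\ge0$. $\mathbb{C}((1/z))$ is the field of formal Laurent series $\sum_{i\in\mathbb{Z}}c_iz^i$ with $c_i\in\mathbb{C}$ and $c_i=0$ for all sufficiently large $i$; it contains $\mathbb{C}(z)$. An element $f\in\mathbb{C}((1/z))$ is algebraic if $P(z,f)=0$ for some nonzero $P(x,y)\in\mathbb{C}[x,y]$. The (formal) Stieltjes transform of a law $\mu$ is $S_\mu(z)=\sum_{n=0}^\infty\mu(\mathbf{X}^n)/z^{n+1}\in\mathbb{C}((1/z))$. A law $\mu$ is called algebraic if $S_\mu(z)$ is algebraic. *)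

(* Defs.v *)
From HB Require Import structures.
From mathcomp Require Import all_boot all_order all_algebra.
From mathcomp Require Import boolp classical_sets functions cardinality fsbigop.
From mathcomp Require Import reals complex.
From mathcomp Require Import zify.

Set Implicit Arguments.
Unset Strict Implicit.
Unset Printing Implicit Defensive.

Import Order.TTheory GRing.Theory Num.Theory.

Local Open Scope ring_scope.

(** * Formal Laurent series in [1/z] *)

(* [lcoef f i] is the coefficient of [z ^ i], for [i : int]. *)

Section Laurent.
Variable K : comNzRingType.

Definition bounded_above (f : int -> K) : Prop :=
  exists N : int, forall i : int, N < i -> f i = 0.

Record laurent := Laurent {
  lcoef : int -> K;
  lcoefP : `[< bounded_above lcoef >] }.

HB.instance Definition _ := [isSub for lcoef].
HB.instance Definition _ := [Choice of laurent by <:].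

Lemma laurentP (f g : laurent) : lcoef f =1 lcoef g -> f = g.
Proof. by move=> fg; apply/val_inj/funext. Qed.

Lemma laurent_bound (f : laurent) :
  exists B : nat, forall i : int, B%:Z < i -> lcoef f i = 0.
Proof.
have [N NP] := asboolW (lcoefP f); exists `|N|%N => i ?; apply: NP; lia.
Qed.

Fact lzero_subproof : `[< bounded_above (fun=> 0) >].
Proof. by apply/asboolP; exists 0. Qed.
Definition lzero := Laurent lzero_subproof.

Fact lopp_subproof (f : laurent) : `[< bounded_above (fun i => - lcoef f i) >].
Proof.
apply/asboolP; have [B BP] := laurent_bound f.
by exists B => i /BP ->; rewrite oppr0.
Qed.
Definition lopp f := Laurent (lopp_subproof f).

Fact ladd_subproof (f g : laurent) :
  `[< bounded_above (fun i => lcoef f i + lcoef g i) >].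
Proof.
apply/asboolP; have [B BP] := laurent_bound f; have [C CP] := laurent_bound g.
by exists (B + C)%N => i ?; rewrite BP ?CP ?addr0//; lia.
Qed.
Definition ladd f g := Laurent (ladd_subproof f g).

Fact laddA : associative ladd.
Proof. by move=> f g h; apply: laurentP => i /=; rewrite addrA. Qed.
Fact laddC : commutative ladd.
Proof. by move=> f g; apply: laurentP => i /=; rewrite addrC. Qed.
Fact ladd0 : left_id lzero ladd.
Proof. by move=> f; apply: laurentP => i /=; rewrite add0r. Qed.
Fact laddN : left_inverse lzero lopp ladd.
Proof. by move=> f; apply: laurentP => i /=; rewrite addNr. Qed.

HB.instance Definition _ := GRing.isZmodule.Build laurent laddA laddC ladd0 laddN.

(* For each [n] only finitely many terms of the sum are nonzero. *)
Definition lmul_coef (f g : int -> K) (n : int) : K :=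
  \sum_(i \in [set: int]) (f i * g (n - i)).

(* The integers [i] with [`|i| <= N], see [mem_window]. *)
Definition window (N : nat) : seq int :=
  [seq k%:Z - N%:Z | k <- iota 0 N.*2.+1].

Lemma mem_window N (i : int) : (i \in window N) = (`|i| <= N)%N.
Proof.
apply/mapP/idP => [[k]|iN]; first by rewrite mem_iota => ? ->; lia.
by exists `|(i + N%:Z)%R|%N; rewrite ?mem_iota; lia.
Qed.

Lemma fsum_window (N : nat) (F : int -> K) :
    (forall i, (N < `|i|)%N -> F i = 0) ->
  \sum_(i \in [set: int]) F i = \sum_(i <- window N) F i.
Proof.
move=> F0; rewrite [RHS]fsbig_seq; last first.
  by rewrite map_inj_uniq ?iota_uniq// => x y; lia.
apply/esym/fsbig_widen => // i [_ /= /negP].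
by rewrite mem_window -ltnNge => /F0.
Qed.

Lemma lmul_coefE N (f g : int -> K) n (B : nat) :
    (forall i, B%:Z < i -> f i = 0) -> (forall i, B%:Z < i -> g i = 0) ->
    (`|n| + B <= N)%N ->
  lmul_coef f g n = \sum_(i <- window N) f i * g (n - i).
Proof.
move=> f0 g0 nN; apply: fsum_window => i Ni.
have [/f0 ->|?] := ltP B%:Z i; first by rewrite mul0r.
by rewrite g0 ?mulr0//; lia.
Qed.

Lemma lmul_coef_eq0 (f g : int -> K) (B C : nat) n :
    (forall i, B%:Z < i -> f i = 0) -> (forall i, C%:Z < i -> g i = 0) ->
  (B + C)%N%:Z < n -> lmul_coef f g n = 0.
Proof.
move=> f0 g0 ?; apply: fsbig1 => i _.
have [/f0 ->|?] := ltP B%:Z i; first by rewrite mul0r.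
by rewrite g0 ?mulr0//; lia.
Qed.

Fact lmul_subproof (f g : laurent) :
  `[< bounded_above (lmul_coef (lcoef f) (lcoef g)) >].
Proof.
apply/asboolP; have [B BP] := laurent_bound f; have [C CP] := laurent_bound g.
by exists (B + C)%N => i; apply: lmul_coef_eq0.
Qed.
Definition lmul f g := Laurent (lmul_subproof f g).

Fact lone_subproof : `[< bounded_above (fun i => (i == 0)%:R) >].
Proof. by apply/asboolP; exists 0 => i; case: eqP => // ->. Qed.
Definition lone := Laurent lone_subproof.

Lemma laurent_bound2 (f g : laurent) : exists B : nat,
  (forall i : int, B%:Z < i -> lcoef f i = 0) /\
  (forall i : int, B%:Z < i -> lcoef g i = 0).
Proof.
have [B BP] := laurent_bound f; have [C CP] := laurent_bound g.
by exists (B + C)%N; split=> i ?; [apply: BP|apply: CP]; lia.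
Qed.

Fact lmulC : commutative lmul.
Proof.
move=> f g; apply: laurentP => n /=; rewrite /lmul_coef.
rewrite (reindex_fsbigT (fun i : int => n - i)); last first.
  by exists (fun i : int => n - i) => i /=; lia.
by apply: eq_fsbigr => i _; rewrite subKr mulrC.
Qed.

Fact lmulA : associative lmul.
Proof.
move=> f g h; apply: laurentP => n /=.
have [B [f0 g0]] := laurent_bound2 f g; have [C h0] := laurent_bound h.
pose D := (B + C)%N.
have {}f0 i : D%:Z < i -> lcoef f i = 0 by move=> ?; apply: f0; lia.
have {}g0 i : D%:Z < i -> lcoef g i = 0 by move=> ?; apply: g0; lia.
have {}h0 i : D%:Z < i -> lcoef h i = 0 by move=> ?; apply: h0; lia.
pose N := (`|n| + 4 * D)%N.
have -> : lmul_coef (lcoef f) (lmul_coef (lcoef g) (lcoef h)) n =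
    \sum_(j <- window N) \sum_(i <- window N)
      lcoef f j * lcoef g (i - j) * lcoef h (n - i).
  rewrite (@lmul_coefE N _ _ _ (D + D)); first last.
  - by rewrite /N; lia.
  - by move=> i; apply: lmul_coef_eq0.
  - by move=> i ?; apply: f0; lia.
  apply: eq_bigr => j _; have [/f0 ->|jD] := ltP D%:Z j.
    by rewrite mul0r big1// => i _; rewrite !mul0r.
  rewrite /lmul_coef (reindex_fsbigT (fun i : int => i - j)); last first.
    by exists (fun i : int => i + j) => i; rewrite (subrK, addrK).
  rewrite (@fsum_window N); last first.
    move=> i Ni; have [/g0 ->|?] := ltP D%:Z (i - j); first by rewrite mul0r.
    by rewrite [X in _ * X]h0 ?mulr0//; rewrite /N in Ni; lia.
  rewrite mulr_sumr; apply: eq_bigr => i _; rewrite mulrA.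
  by congr (_ * lcoef h _); lia.
rewrite exchange_big/= (@lmul_coefE N _ _ _ (D + D)); first last.
- by rewrite /N; lia.
- by move=> i ?; apply: h0; lia.
- by move=> i; apply: lmul_coef_eq0.
apply: eq_bigr => i _; rewrite -mulr_suml.
have [/h0 ->|iD] := ltP D%:Z (n - i); first by rewrite !mulr0.
congr (_ * _); apply/esym/fsum_window => j Nj.
have [/f0 ->|?] := ltP D%:Z j; first by rewrite mul0r.
by rewrite g0 ?mulr0//; rewrite /N in Nj; lia.
Qed.

Fact lmul1 : left_id lone lmul.
Proof.
move=> f; apply: laurentP => n /=.
rewrite /lmul_coef (@fsum_window 0) => [|i i0]; last first.
  by case: eqP => [?|]; rewrite ?mul0r//; lia.
by rewrite /window big_seq1 /= mul1r; congr (lcoef f _); lia.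
Qed.

Fact lmulDl : left_distributive lmul +%R.
Proof.
move=> f g h; apply: laurentP => n /=.
have [B [f0 g0]] := laurent_bound2 f g; have [C h0] := laurent_bound h.
pose D := (B + C)%N; pose N := (`|n| + D)%N.
have {}f0 i : D%:Z < i -> lcoef f i = 0 by move=> ?; apply: f0; lia.
have {}g0 i : D%:Z < i -> lcoef g i = 0 by move=> ?; apply: g0; lia.
have {}h0 i : D%:Z < i -> lcoef h i = 0 by move=> ?; apply: h0; lia.
rewrite !(@lmul_coefE N _ _ _ D)//; last first.
  by move=> i iD; rewrite f0// g0// addr0.
by rewrite -big_split; apply: eq_bigr => i _; rewrite mulrDl.
Qed.

Fact lone_neq0 : lone != 0.
Proof.
by apply/eqP => /(congr1 (fun f => lcoef f 0)) /eqP; rewrite /= oner_eq0.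
Qed.

HB.instance Definition _ :=
  GRing.Zmodule_isComNzRing.Build laurent lmulA lmulC lmul1 lmulDl lone_neq0.

(** ** The embedding of [K[z]] and algebraic elements *)

Definition laurent_of_poly_coef (p : {poly K}) (i : int) : K :=
  if i is Posz n then p`_n else 0.

Fact laurent_of_poly_subproof p : `[< bounded_above (laurent_of_poly_coef p) >].
Proof.
apply/asboolP; exists (size p)%:Z => -[n|//] /= pn.
by rewrite nth_default//; lia.
Qed.
Definition laurent_of_poly p := Laurent (laurent_of_poly_subproof p).

Fact laurent_of_poly_is_zmod_morphism : zmod_morphism laurent_of_poly.
Proof.
by move=> p r; apply: laurentP => -[n|n] /=; rewrite ?coefB// subr0.
Qed.

Fact laurent_of_poly_is_monoid_morphism : monoid_morphism laurent_of_poly.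
Proof.
split=> [|p r]; apply: laurentP => -[n|n] /=; first by rewrite coef1; case: n.
- by [].
- rewrite coefM /lmul_coef (@fsum_window n) => [|[i|i]]; last 2 first.
  + move=> ni; case E: (n%:Z - i%:Z) => [k|k]; first by lia.
    by rewrite mulr0.
  + by rewrite mul0r.
  rewrite /window big_map -[iota 0 _]/(index_iota 0 n.*2.+1).
  rewrite (@big_cat_nat _ _ _ n)//=; last by lia.
  rewrite [X in _ = X + _]big_nat [X in _ = X + _]big1 ?add0r => [|k kn]; last first.
    by case E: (k%:Z - n%:Z) => [m|m]; [lia|rewrite mul0r].
  have shift m F : \sum_(n <= k < n + m) F k = \sum_(k < m) F (k + n)%N :> K.
    by rewrite -{1}[n]add0n big_addn addKn big_mkord.
  rewrite -addnn -addnS shift.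
  apply: eq_bigr => k _; rewrite PoszD addrK /=.
  by have kn : (k <= n)%N := ltn_ord k; rewrite (subzn kn).
rewrite /lmul_coef fsbig1// => -[i|i] _ /=; last by rewrite mul0r.
by case E: (Negz n - i%:Z) => [k|k]; [lia|rewrite mulr0].
Qed.

HB.instance Definition _ := GRing.isZmodMorphism.Build {poly K} laurent
  laurent_of_poly laurent_of_poly_is_zmod_morphism.
HB.instance Definition _ := GRing.isMonoidMorphism.Build {poly K} laurent
  laurent_of_poly laurent_of_poly_is_monoid_morphism.

(* [P : {poly {poly K}}] stands for P(x,y), with outer variable y, so that
   [(map_poly laurent_of_poly P).[f]] is P(z,f). *)
Definition algebraic (f : laurent) : Prop :=
  exists2 P : {poly {poly K}}, P != 0 & (map_poly laurent_of_poly P).[f] = 0.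

(** ** Laws, viewed as linear functionals on [K[X]] *)

(* [Negz n] is [- (n + 1)]. *)
Definition stieltjes_coef (mu : {poly K} -> K) (i : int) : K :=
  if i is Negz n then mu 'X^n else 0.

Fact stieltjes_subproof mu : `[< bounded_above (stieltjes_coef mu) >].
Proof. by apply/asboolP; exists 0 => -[]. Qed.
Definition stieltjes mu := Laurent (stieltjes_subproof mu).

Definition algebraic_law (mu : {poly K} -> K) : Prop :=
  algebraic (stieltjes mu).

End Laurent.

Section NCProbability.
Variables (K : comNzRingType) (A : algType K).

Definition is_state (phi : {scalar A}) : Prop := phi 1 = 1.

Definition law (phi : {scalar A}) (x : A) (P : {poly K}) : K :=
  phi (horner_alg x P).

Fact law_is_scalar phi x : scalar (law phi x).
Proof. by move=> c P Q; rewrite /law linearP /= mulr_algl scalarP. Qed.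
HB.instance Definition _ phi x :=
  GRing.isLinear.Build K {poly K} K *%R (law phi x) (law_is_scalar phi x).

Lemma lawXn phi x n : law phi x 'X^n = phi (x ^+ n).
Proof. by rewrite /law rmorphXn /= horner_algX. Qed.

Definition monomial (I : Type) (x : I -> A) (w : seq I) : A := \prod_(i <- w) x i.

Definition nc_polynomials (I : Type) (x : I -> A) : set A :=
  [set y | exists s : seq (K * seq I),
     y = \sum_(m <- s) m.1 *: monomial x m.2]%classic.

(* Intended for subalgebras [B i] containing [1]. *)
Definition free_subalgebras (phi : {scalar A}) (I : Type) (B : I -> set A) :
    Prop :=
  forall (k : nat) (i : 'I_k -> I) (y : 'I_k -> A), (0 < k)%N ->
    (forall a b : 'I_k, b = a.+1 :> nat -> i a <> i b) ->
    (forall a, B (i a) (y a)) -> (forall a, phi (y a) = 0) ->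
  phi (\prod_(a < k) y a) = 0.

Definition freely_independent (phi : {scalar A}) (I : Type) (x : I -> A) :
    Prop :=
  free_subalgebras phi (fun i => nc_polynomials (fun _ : unit => x i)).

End NCProbability.

(** * The matrix algebra over a [K]-algebra *)

(* Only positive sizes [n.+1] form a (nontrivial) algebra.
   ['M[A]_n] is canonically a module over [A]; the alias carries the
   [K]-algebra structure instead. *)
Definition algmx (K : comNzRingType) (A : algType K) (n : nat) : Type :=
  'M[A]_n.

Section MatrixAlgebra.
Variables (K : comNzRingType) (A : algType K) (n : nat).
Local Notation M := (algmx A n.+1).

HB.instance Definition _ := GRing.NzRing.copy M 'M[A]_n.+1.

Definition algmx_scale (c : K) (X : M) : M := \matrix_(i, j) (c *: X i j).

Fact algmx_scaleA c d X : algmx_scale c (algmx_scale d X) = algmx_scale (c * d) X.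
Proof. by apply/matrixP => i j; rewrite !mxE scalerA. Qed.
Fact algmx_scale1 : left_id 1 algmx_scale.
Proof. by move=> X; apply/matrixP => i j; rewrite !mxE scale1r. Qed.
Fact algmx_scaleDr : right_distributive algmx_scale +%R.
Proof. by move=> c X Y; apply/matrixP => i j; rewrite !mxE scalerDr. Qed.
Fact algmx_scaleDl X : {morph algmx_scale^~ X : c d / c + d}.
Proof. by move=> c d; apply/matrixP => i j; rewrite !mxE scalerDl. Qed.
HB.instance Definition _ := GRing.Zmodule_isLmodule.Build K M
  algmx_scaleA algmx_scale1 algmx_scaleDr algmx_scaleDl.

Fact algmx_scaleAl (c : K) (X Y : M) : c *: (X * Y) = c *: X * Y.
Proof.
apply/matrixP => i j; rewrite !mxE scaler_sumr; apply: eq_bigr => k _.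
by rewrite mxE scalerAl.
Qed.
HB.instance Definition _ := GRing.Lmodule_isLalgebra.Build K M algmx_scaleAl.

Fact algmx_scaleAr (c : K) (X Y : M) : c *: (X * Y) = X * (c *: Y).
Proof.
apply/matrixP => i j; rewrite !mxE scaler_sumr; apply: eq_bigr => k _.
by rewrite mxE scalerAr.
Qed.
HB.instance Definition _ := GRing.Lalgebra_isAlgebra.Build K M algmx_scaleAr.

End MatrixAlgebra.

Section MatrixState.
Variables (K : fieldType) (A : algType K) (phi : {scalar A}) (n : nat).

Definition mxstate (X : algmx A n.+1) : K := n.+1%:R^-1 * \sum_i phi (X i i).

Fact mxstate_is_scalar : scalar mxstate.
Proof.
move=> c X Y; rewrite /mxstate mulrCA -mulrDr; congr (_ * _).
rewrite mulr_sumr -big_split; apply: eq_bigr => i _.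
by rewrite !mxE scalarP.
Qed.
HB.instance Definition _ :=
  GRing.isLinear.Build K (algmx A n.+1) K *%R mxstate mxstate_is_scalar.

End MatrixState.
Arguments mxstate {K A} phi n X.

Lemma mxstate_is_state (K : numFieldType) (A : algType K) (phi : {scalar A}) n :
  is_state phi -> is_state (mxstate phi n).
Proof.
rewrite /is_state /= /mxstate => phi1.
under eq_bigr do rewrite mxE eqxx phi1.
by rewrite sumr_const card_ord mulVf// pnatr_eq0.
Qed.

(* Main.v *)
Require Import Defs.
From HB Require Import structures.
From mathcomp Require Import all_boot all_order all_algebra.
From mathcomp Require Import boolp classical_sets reals complex.
From mathcomp Require Import zify ring.

(* Write [X] in terms of words in the [x_k] and linearize: up to a change of
   variable [t = s^d], the moment series of [X] is read off the entries of
   the expectation [G] of the inverse of [1 - M0 - sum_k M_k x_k], where [M0] and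
   the [M_k] are matrices over [K[s]] that vanish at [s = 0].  Choose matrices
   [b_k] over [K[[s]]] with [g_k b_k = G M_k] and [G (1 - M0) = 1 + sum_k (g_k - 1)],
   where [g_k] is the moment series of [x_k] evaluated at [b_k], that is, the
   expectation of [(1 - b_k x_k)^-1]; these equations are contracting for the
   [s]-adic topology.  Freeness kills all alternating words in the centered
   elements [(1 - b_k x_k)^-1 g_k^-1 - 1], which identifies [G] with the
   expectation wanted.

   For algebraicity, Hensel's lemma turns the algebraic equation of each moment
   series into [h = u q0 + h^2 q1] with [q0], [q1] polynomials in [u] and [h],
   which makes sense for a matrix in place of [u].  If the moment series [f] of [X]
   were transcendental over [K(t)], some derivation [D] of the finitely generated ring
   containing [s] and all matrix entries would kill [K[t]] and not [f].  Applying
   [D] to the contracting equations shows that [D f] is divisible by every power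
   of [s], a contradiction. *)

Set Implicit Arguments.
Unset Strict Implicit.
Unset Printing Implicit Defensive.

Import Order.TTheory GRing.Theory Num.Theory.

Local Open Scope ring_scope.

(** * Formal power series over a noncommutative ring *)

Section Series.
Variable A : nzRingType.

Record series := Series { scoef : nat -> A }.

HB.instance Definition _ := [isNew for scoef].
HB.instance Definition _ := [Choice of series by <:].

Lemma seriesP (f g : series) : scoef f =1 scoef g -> f = g.
Proof. by move=> fg; apply/val_inj/funext. Qed.

Definition szero := Series (fun=> 0).
Definition sopp f := Series (fun n => - scoef f n).
Definition sadd f g := Series (fun n => scoef f n + scoef g n).

Fact saddA : associative sadd.
Proof. by move=> f g h; apply: seriesP => n /=; rewrite addrA. Qed.
Fact saddC : commutative sadd.
Proof. by move=> f g; apply: seriesP => n /=; rewrite addrC. Qed.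
Fact sadd0 : left_id szero sadd.
Proof. by move=> f; apply: seriesP => n /=; rewrite add0r. Qed.
Fact saddN : left_inverse szero sopp sadd.
Proof. by move=> f; apply: seriesP => n /=; rewrite addNr. Qed.

HB.instance Definition _ := GRing.isZmodule.Build series saddA saddC sadd0 saddN.

Definition sone := Series (fun n => (n == 0%N)%:R).
Definition smul f g :=
  Series (fun n => \sum_(i < n.+1) scoef f i * scoef g (n - i)%N).

Definition strunc n f : {poly A} := \poly_(i < n) scoef f i.

(** Truncation loses nothing in degrees below [n], so associativity is inherited from [{poly A}]. *)
Lemma smul_strunc f g n k : (k < n)%N ->
  scoef (smul f g) k = (strunc n f * strunc n g)`_k.
Proof.
move=> kn; rewrite /= coefM; apply: eq_bigr => i _.
have ik : (i <= k)%N by rewrite -ltnS.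
by rewrite !coef_poly (leq_ltn_trans ik kn) (leq_ltn_trans (leq_subr _ _) kn).
Qed.

Fact smulA : associative smul.
Proof.
move=> f g h; apply: seriesP => n.
transitivity ((strunc n.+1 f * (strunc n.+1 g * strunc n.+1 h))`_n).
  rewrite coefM /=; apply: eq_bigr => i _.
  by rewrite coef_poly ltn_ord -smul_strunc// ltnS leq_subr.
rewrite mulrA coefM /=; apply: eq_bigr => i _.
by rewrite -smul_strunc// coef_poly ltnS leq_subr.
Qed.
Fact smul1f : left_id sone smul.
Proof.
move=> f; apply: seriesP => n /=; rewrite big_ord_recl /= mul1r subn0.
by rewrite big1 ?addr0// => i _; rewrite mul0r.
Qed.
Fact smulf1 : right_id sone smul.
Proof.
move=> f; apply: seriesP => n /=; rewrite big_ord_recr /= subnn mulr1.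
rewrite big1 ?add0r// => i _.
by rewrite subn_eq0 leqNgt ltn_ord mulr0.
Qed.
Fact smulDl : left_distributive smul +%R.
Proof.
move=> f g h; apply: seriesP => n /=.
by rewrite -big_split; apply: eq_bigr => i _; rewrite mulrDl.
Qed.
Fact smulDr : right_distributive smul +%R.
Proof.
move=> f g h; apply: seriesP => n /=.
by rewrite -big_split; apply: eq_bigr => i _; rewrite mulrDr.
Qed.
Fact sone_neq0 : sone != 0.
Proof.
by apply/eqP => /(congr1 (fun f => scoef f 0)) /eqP; rewrite /= oner_eq0.
Qed.
HB.instance Definition _ := GRing.Zmodule_isNzRing.Build series
  smulA smul1f smulf1 smulDl smulDr sone_neq0.

Lemma scoef0 n : scoef 0 n = 0. Proof. by []. Qed.
Lemma scoefD f g n : scoef (f + g) n = scoef f n + scoef g n. Proof. by []. Qed.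
Lemma scoefN f n : scoef (- f) n = - scoef f n. Proof. by []. Qed.
Lemma scoef1 n : scoef 1 n = (n == 0%N)%:R. Proof. by []. Qed.
Lemma scoefM f g n :
  scoef (f * g) n = \sum_(i < n.+1) scoef f i * scoef g (n - i)%N.
Proof. by []. Qed.

Lemma scoef_sum (I : Type) (r : seq I) (P : pred I) (F : I -> series) n :
  scoef (\sum_(i <- r | P i) F i) n = \sum_(i <- r | P i) scoef (F i) n.
Proof. exact: (big_morph (fun f => scoef f n) (fun f g => scoefD f g n) (scoef0 n)). Qed.

Lemma scoef0M f g : scoef (f * g) 0 = scoef f 0 * scoef g 0.
Proof. by rewrite scoefM big_ord1 subn0. Qed.

Definition sconst (a : A) := Series (fun n => if n == 0%N then a else 0).
Definition svar := Series (fun n => (n == 1%N)%:R).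

Lemma scoefCM a f n : scoef (sconst a * f) n = a * scoef f n.
Proof.
rewrite scoefM big_ord_recl /= subn0 big1 ?addr0// => i _.
by rewrite mul0r.
Qed.

Lemma scoefMC a f n : scoef (f * sconst a) n = scoef f n * a.
Proof.
rewrite scoefM big_ord_recr /= subnn eqxx big1 ?add0r// => i _.
by rewrite subn_eq0 leqNgt ltn_ord mulr0.
Qed.

Fact sconst_zmod : zmod_morphism sconst.
Proof. by move=> a b; apply: seriesP => -[|n] //=; rewrite subr0. Qed.
Fact sconst_monoid : monoid_morphism sconst.
Proof.
by split=> [|a b]; apply: seriesP => -[|n]//; rewrite scoefCM //= ?mulr0.
Qed.
HB.instance Definition _ := GRing.isZmodMorphism.Build A series sconst sconst_zmod.
HB.instance Definition _ := GRing.isMonoidMorphism.Build A series sconst sconst_monoid.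

Lemma scoefXM f n : scoef (svar * f) n = if n is m.+1 then scoef f m else 0.
Proof.
rewrite scoefM; case: n => [|n]; first by rewrite big_ord1 mul0r.
rewrite !big_ord_recl /= mul0r add0r mul1r subSS subn0 big1 ?addr0// => i _.
by rewrite mul0r.
Qed.

Lemma scoefXnM f k n :
  scoef (svar ^+ k * f) n = if (k <= n)%N then scoef f (n - k) else 0.
Proof.
elim: k n => [|k IH] n; first by rewrite expr0 mul1r subn0.
by rewrite exprS -mulrA scoefXM; case: n => [|n]//; rewrite IH.
Qed.

Lemma scoefXn k n : scoef (svar ^+ k) n = (n == k)%:R.
Proof.
rewrite -[svar ^+ k]mulr1 scoefXnM scoef1.
case: leqP => kn; last by case: eqP => //; lia.
by have -> : (n - k == 0)%N = (n == k) by apply/eqP/eqP; lia.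
Qed.

(** Divisibility by [svar ^+ n], followed by congruence modulo it. *)
Definition sord n f := forall k, (k < n)%N -> scoef f k = 0.
Definition eqmod n f g := forall k, (k < n)%N -> scoef f k = scoef g k.

Lemma sordD n f g : sord n f -> sord n g -> sord n (f + g).
Proof. by move=> f0 g0 k kn; rewrite scoefD f0// g0// addr0. Qed.
Lemma sordN n f : sord n f -> sord n (- f).
Proof. by move=> f0 k kn; rewrite scoefN f0// oppr0. Qed.
Lemma sordM m n f g : sord m f -> sord n g -> sord (m + n) (f * g).
Proof.
move=> f0 g0 k kmn; rewrite scoefM big1// => i _.
have [im|im] := ltnP i m; first by rewrite f0// mul0r.
by rewrite g0 ?mulr0//; have := ltn_ord i; lia.
Qed.
Lemma sordMl n f g : sord n f -> sord n (f * g).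
Proof. by move=> f0; rewrite -[n]addn0; apply: sordM. Qed.
Lemma sordMr n f g : sord n g -> sord n (f * g).
Proof. by move=> g0; rewrite -[n]add0n; apply: sordM. Qed.
Lemma sord1P f : sord 1 f <-> scoef f 0 = 0.
Proof. by split=> [->|f0 [|]]. Qed.
Lemma sordX n f : scoef f 0 = 0 -> sord n (f ^+ n).
Proof.
move/sord1P => f0; elim: n => [|n IH]; first by [].
by rewrite exprS -add1n; apply: sordM.
Qed.
Lemma sord_eq0 f : (forall n, sord n f) -> f = 0.
Proof. by move=> f0; apply: seriesP => n; apply: (f0 n.+1). Qed.

Lemma sord_XnM n f : sord n f -> exists g, f = svar ^+ n * g.
Proof.
move=> f0; exists (Series (fun k => scoef f (n + k))).
apply: seriesP => k; rewrite scoefXnM.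
by case: leqP => nk; [rewrite /= subnKC|rewrite f0].
Qed.

Lemma svarX_lreg n f g : svar ^+ n * f = svar ^+ n * g -> f = g.
Proof.
move=> fg; apply: seriesP => k.
by have := congr1 (fun h => scoef h (n + k)%N) fg; rewrite !scoefXnM leq_addr addKn.
Qed.

Lemma eqmodD n f f' g g' : eqmod n f f' -> eqmod n g g' -> eqmod n (f + g) (f' + g').
Proof. by move=> ff gg k kn; rewrite !scoefD ff// gg. Qed.
Lemma eqmodN n f f' : eqmod n f f' -> eqmod n (- f) (- f').
Proof. by move=> ff k kn; rewrite !scoefN ff. Qed.
Lemma eqmodM n f f' g g' : eqmod n f f' -> eqmod n g g' -> eqmod n (f * g) (f' * g').
Proof.
move=> ff gg k kn; rewrite !scoefM; apply: eq_bigr => i _.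
by rewrite ff ?gg//; have := ltn_ord i; lia.
Qed.
(** The coefficients of [f] and [f'] in degree [n], which may differ, only meet the zero constant
    terms of [g] and [g']. The contraction in [subordination] rests on this gain of one degree and
    on its mirror image [eqmodSM]. *)
Lemma eqmodMS n f f' g g' : scoef g 0 = 0 -> scoef g' 0 = 0 ->
  eqmod n f f' -> eqmod n.+1 g g' -> eqmod n.+1 (f * g) (f' * g').
Proof.
move=> g0 g'0 ff gg k kn; rewrite !scoefM; apply: eq_bigr => i _.
have [ik|ik] := ltnP i k; first by rewrite ff ?gg//; lia.
have -> : (k - i = 0)%N by have := ltn_ord i; lia.
by rewrite g0 g'0 !mulr0.
Qed.
Lemma eqmodSM n f f' g g' : scoef f 0 = 0 -> scoef f' 0 = 0 ->
  eqmod n.+1 f f' -> eqmod n g g' -> eqmod n.+1 (f * g) (f' * g').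
Proof.
move=> f0 f'0 ff gg k kn; rewrite !scoefM; apply: eq_bigr => -[[|i] ik] _ /=.
  by rewrite f0 f'0 !mul0r.
by rewrite ff ?gg//; lia.
Qed.
Lemma eqmod_sum n (I : Type) (r : seq I) (P : pred I) (F F' : I -> series) :
  (forall i, P i -> eqmod n (F i) (F' i)) ->
  eqmod n (\sum_(i <- r | P i) F i) (\sum_(i <- r | P i) F' i).
Proof.
by move=> FF k kn; rewrite !scoef_sum; apply: eq_bigr => i Pi; apply: FF.
Qed.
Lemma eqmodX n f f' m : eqmod n f f' -> eqmod n (f ^+ m) (f' ^+ m).
Proof. by move=> ff; elim: m => [//|m IH]; rewrite !exprS; apply: eqmodM. Qed.
Lemma eqmod_trans n f g h : eqmod n f g -> eqmod n g h -> eqmod n f h.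
Proof. by move=> fg gh k kn; rewrite fg// gh. Qed.
Lemma eqmod_eq f g : (forall n, eqmod n f g) -> f = g.
Proof. by move=> fg; apply: seriesP => n; apply: (fg n.+1). Qed.

End Series.
Arguments svar {A}.

(** * Coefficientwise maps, commutative coefficients, integrality *)

Section MapSeries.
Variables (A B : nzRingType).

Definition smap (f : A -> B) (a : series A) := Series (fun n => f (scoef a n)).

Variable f : {rmorphism A -> B}.
Fact smap_zmod : zmod_morphism (smap f).
Proof. by move=> a b; apply: seriesP => n /=; rewrite rmorphB. Qed.
Fact smap_monoid : monoid_morphism (smap f).
Proof.
split=> [|a b]; apply: seriesP => n /=; first by rewrite rmorph_nat.
by rewrite rmorph_sum; apply: eq_bigr => i _; rewrite rmorphM.
Qed.
HB.instance Definition _ := GRing.isZmodMorphism.Build (series A) (series B) (smap f) smap_zmod.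
HB.instance Definition _ := GRing.isMonoidMorphism.Build (series A) (series B) (smap f) smap_monoid.
End MapSeries.

Section ComSeries.
Variable A : comNzRingType.
Fact smulC : commutative (@smul A).
Proof.
move=> f g; apply: seriesP => n /=; rewrite (reindex_inj rev_ord_inj) /=.
apply: eq_bigr => i _; rewrite mulrC subSS subKn//.
by rewrite -ltnS.
Qed.
HB.instance Definition _ := GRing.PzRing_hasCommutativeMul.Build (series A) smulC.

Definition spoly (p : {poly A}) : series A := Series (fun n => p`_n).
Fact spoly_zmod : zmod_morphism spoly.
Proof. by move=> p r; apply: seriesP => n /=; rewrite coefB. Qed.
Fact spoly_monoid : monoid_morphism spoly.
Proof.
split=> [|p r]; apply: seriesP => n /=; first by rewrite coef1.
by rewrite coefM.
Qed.
HB.instance Definition _ := GRing.isZmodMorphism.Build {poly A} (series A) spoly spoly_zmod.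
HB.instance Definition _ := GRing.isMonoidMorphism.Build {poly A} (series A) spoly spoly_monoid.

Lemma spolyC c : spoly c%:P = sconst c.
Proof. by apply: seriesP => -[|n]; rewrite /= coefC. Qed.
Lemma spolyX : spoly 'X = svar.
Proof. by apply: seriesP => n; rewrite /= coefX. Qed.
End ComSeries.

Section DomainSeries.
Variable K : fieldType.

Lemma sdomain (f g : series K) : f * g = 0 -> f = 0 \/ g = 0.
Proof.
move=> fg; have [->|f0] := pselect (f = 0); [by left|right].
have nz (h : series K) : h <> 0 ->
    exists n, scoef h n != 0 /\ sord n h.
  move=> h0; have exn : exists n, scoef h n != 0.
    apply/not_existsP => hn; apply: h0; apply: seriesP => n.
    by apply/eqP/negPn/negP/hn.
  case: (ex_minnP exn) => n hn nmin; exists n; split=> // k kn.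
  by apply/eqP/negPn/negP => /nmin; lia.
have [n [fn n0]] := nz _ f0.
apply/not_notP => /nz[m [gm m0]].
(* In degree [n + m] only the product of the two lowest nonzero coefficients survives. *)
have := congr1 (fun h => scoef h (n + m)) fg.
have nP : (n < (n + m).+1)%N by lia.
rewrite /= (bigD1 (Ordinal nP))//= addKn big1 ?addr0 => [|i].
  by apply/eqP; rewrite mulf_neq0.
rewrite -val_eqE /= => iN; have [im|im] := ltnP i n; first by rewrite n0// mul0r.
by rewrite m0 ?mulr0//; have := ltn_ord i; move/eqP: iN; lia.
Qed.

End DomainSeries.

(** ** Substitution of a series without constant term *)

Section Substitution.
Variables (K : comNzRingType) (C : nzRingType) (kappa : {rmorphism K -> C}).
Hypothesis kappa_central : forall c y, kappa c * y = y * kappa c.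
Variable b : series C.
Hypothesis b0 : scoef b 0 = 0.

(** Since [b] has no constant term, [b ^+ k] vanishes in degrees below [k], so the sum stopped at
    [n] is the whole coefficient of the substituted series. *)
Definition sev (h : series K) : series C :=
  Series (fun n => \sum_(k < n.+1) kappa (scoef h k) * scoef (b ^+ k) n).

Lemma scoef_sev h n :
  scoef (sev h) n = \sum_(k < n.+1) kappa (scoef h k) * scoef (b ^+ k) n.
Proof. by []. Qed.

Lemma sconst_kappa_comm : commr_rmorph (@sconst C \o kappa) b.
Proof. by move=> c; apply: seriesP => n; rewrite [LHS]scoefMC [RHS]scoefCM kappa_central. Qed.

Let pev := horner_morph sconst_kappa_comm.

Let scoef_pev (p : {poly K}) m n : (size p <= m)%N ->
  scoef (pev p) n = \sum_(k < m) kappa p`_k * scoef (b ^+ k) n.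
Proof.
move=> pm; rewrite /pev /horner_morph (@horner_coef_wide _ m); last first.
  exact: leq_trans (size_poly _ _) _.
rewrite scoef_sum; apply: eq_bigr => k _.
by rewrite coef_map [LHS]scoefCM.
Qed.

Let pev_sord n (p : {poly K}) : (forall k, (k < n)%N -> p`_k = 0) -> sord n (pev p).
Proof.
move=> p0 k kn; rewrite (@scoef_pev _ (size p))// big1// => i _.
have [/p0 ->|ni] := ltnP i n; first by rewrite rmorph0 mul0r.
by rewrite (@sordX _ i)// ?mulr0//; lia.
Qed.

Let sev_pev n h : eqmod n (sev h) (pev (strunc n h)).
Proof.
move=> k kn; rewrite (@scoef_pev _ n) ?size_poly// [LHS]/=.
rewrite (big_ord_widen n (fun i => kappa (scoef h i) * scoef (b ^+ i) k)%R kn).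
rewrite big_mkcond /=; apply: eq_bigr => i _; rewrite coef_poly ltn_ord.
by case: leqP => // ki; rewrite (@sordX _ i)// mulr0.
Qed.

Lemma sev_zmod : zmod_morphism sev.
Proof.
move=> f g; apply: seriesP => n; rewrite scoefD scoefN /= -sumrB.
by apply: eq_bigr => k _; rewrite rmorphB mulrBl.
Qed.

(** Modulo [svar ^+ n] a series may be replaced by its truncation, and on polynomials substitution
    is the ring morphism [pev]. *)
Lemma sev_monoid : monoid_morphism sev.
Proof.
split=> [|f g].
  apply: seriesP => n /=; rewrite big_ord_recl /= rmorph1 mul1r.
  by rewrite big1 ?addr0// => i _; rewrite (rmorph0 kappa) mul0r.
apply: eqmod_eq => n; apply: (eqmod_trans (@sev_pev n _)).
apply: (@eqmod_trans _ _ _ (pev (strunc n f) * pev (strunc n g))); last first.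
  by apply: eqmodM => k kn; exact/esym/sev_pev.
rewrite -rmorphM => k kn; apply/eqP; rewrite -subr_eq0 -scoefN -scoefD -rmorphB.
apply/eqP/(@pev_sord n) => // i im.
by rewrite coefB coef_poly im (smul_strunc _ _ im) subrr.
Qed.

Lemma sevC c : sev (sconst c) = sconst (kappa c).
Proof.
apply: seriesP => n /=; rewrite big_ord_recl /=.
rewrite big1 ?addr0 => [|i _]; last by rewrite rmorph0 mul0r.
by case: n => [|n]; rewrite ?mulr1 ?mulr0.
Qed.

Lemma sevX : sev svar = b.
Proof.
have k0 n : n != 1%N -> kappa (scoef svar n) = 0.
  by move=> /negPf n1; rewrite /= n1 rmorph0.
have k1 : kappa (scoef svar 1) = 1 by rewrite /= rmorph1.
apply: seriesP => -[|n]; rewrite scoef_sev.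
  by rewrite big_ord1 k0// mul0r b0.
rewrite !big_ord_recl k0// k1 mul0r add0r mul1r expr1.
by rewrite big1 ?addr0// => i _; rewrite mul0r.
Qed.

Lemma scoef_sev0 h : scoef (sev h) 0 = kappa (scoef h 0).
Proof. by rewrite /= big_ord1 /= mulr1. Qed.

Lemma sevD f g : sev (f + g) = sev f + sev g.
Proof.
apply: seriesP => n; rewrite scoefD !scoef_sev -big_split.
by apply: eq_bigr => k _; rewrite scoefD rmorphD mulrDl.
Qed.

Lemma sevM f g : sev (f * g) = sev f * sev g.
Proof. exact: sev_monoid.2. Qed.

(** The geometric series: substituting [b] in it inverts [1 - b]. *)
Definition sgeo : series K := Series (fun=> 1).

Lemma sgeoV : (1 - svar) * sgeo = 1.
Proof.
apply: seriesP => n; rewrite mulrBl mul1r scoefD scoefN scoefXM scoef1 /=.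
by case: n => [|n]; rewrite ?subr0 ?subrr.
Qed.

Lemma sevV : (1 - b) * sev sgeo = 1.
Proof. by rewrite -sevX -[1]sev_monoid.1 -sev_zmod -sev_monoid.2 sgeoV. Qed.

Lemma sevVr : sev sgeo * (1 - b) = 1.
Proof. by rewrite -sevX -[1]sev_monoid.1 -sev_zmod -sev_monoid.2 mulrC sgeoV. Qed.

End Substitution.

Lemma sev_eqmod (K : comNzRingType) (C : nzRingType) (kappa : {rmorphism K -> C})
    (b b' : series C) h n :
  eqmod n b b' -> eqmod n (sev kappa b h) (sev kappa b' h).
Proof.
move=> bb k kn /=; apply: eq_bigr => i _; congr (_ * _).
exact: (@eqmodX _ n).
Qed.

(** * Fixed points of contractions on families of series *)

Section FixedPoint.
Variables (A : nzRingType) (I : Type) (Phi : (I -> series A) -> I -> series A).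
Hypothesis Phi0 : forall b, (forall i, scoef (b i) 0 = 0) ->
  forall i, scoef (Phi b i) 0 = 0.
Hypothesis PhiS : forall n b b', (forall i, scoef (b i) 0 = 0) ->
  (forall i, scoef (b' i) 0 = 0) -> (forall i, eqmod n (b i) (b' i)) ->
  forall i, eqmod n.+1 (Phi b i) (Phi b' i).

(** The iterates of [Phi] from 0 stabilize degree by degree: iterate [n.+1] is final in degree [n],
    so the limit takes its coefficient from there. *)
Lemma series_fixpoint : exists b : I -> series A,
  (forall i, scoef (b i) 0 = 0) /\ (forall i, b i = Phi b i).
Proof.
pose a n := iter n Phi (fun=> 0).
have a0 n i : scoef (a n i) 0 = 0.
  by elim: n i => [|n IH] i //; rewrite /a iterS Phi0.
have aS n m i : (n <= m)%N -> eqmod n (a n i) (a m i).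
  elim: n m i => [//|n IH] [//|m] i nm; apply: PhiS => // j.
  exact: IH.
pose b i := Series (fun n => scoef (a n.+1 i) n).
have ba n i : eqmod n (b i) (a n i).
  by move=> k kn /=; apply: (aS k.+1 n i kn).
have b0 i : scoef (b i) 0 = 0 by apply: a0.
exists b; split=> // i; apply: eqmod_eq => -[//|n].
apply: (eqmod_trans (@ba n.+1 i)) => k kn; rewrite /a iterS.
apply: (@PhiS n (a n) b _ _ _ i k kn) => //.
by move=> j l ln; exact/esym/ba.
Qed.
End FixedPoint.

(** ** The subordination equations *)

Section Subordination.
Variables (K : comNzRingType) (B : nzRingType) (kappa : {rmorphism K -> B}).
Hypothesis kappa_central : forall c y, kappa c * y = y * kappa c.
Variables (q : nat) (mu : 'I_q -> series K) (M0 : series B) (M : 'I_q -> series B).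
Hypothesis mu0 : forall k, scoef (mu k) 0 = 1.
Hypothesis M00 : scoef M0 0 = 0.
Hypothesis M0k : forall k, scoef (M k) 0 = 0.

(** The last equation is linear in [G] and is solved by inverting [1 - M0]. What remains is a
    fixed-point equation in [b] alone, contracting because every factor depending on [b] is
    multiplied by a series without constant term. *)
Lemma subordination : exists (b : 'I_q -> series B) (G : series B),
  [/\ forall k, scoef (b k) 0 = 0,
      forall k, b k = G * M k - (sev kappa (b k) (mu k) - 1) * b k
    & G = 1 + \sum_k (sev kappa (b k) (mu k) - 1) + G * M0].
Proof.
pose G b := (1 + \sum_k (sev kappa (b k) (mu k) - 1)) * sev kappa M0 (sgeo K).
pose Phi b k := G b * M k - (sev kappa (b k) (mu k) - 1) * b k.
have g0 b (k : 'I_q) : scoef (sev kappa (b k) (mu k) - 1) 0 = 0.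
  by rewrite scoefD scoefN scoef_sev0 mu0 rmorph1 subrr.
have [b0 b|n b b' b0 b'0 bb k|b [b0 bE]] := @series_fixpoint B 'I_q Phi.
- by move=> k; rewrite scoefD scoefN !scoef0M M0k g0 mulr0 mul0r subr0.
- have gg l : eqmod n (sev kappa (b l) (mu l) - 1) (sev kappa (b' l) (mu l) - 1).
    by apply: eqmodD => //; apply: sev_eqmod.
  apply: eqmodD; last first.
    apply/eqmodN; apply: (eqmod_trans (g := (sev kappa (b k) (mu k) - 1) * b' k)).
      by apply: eqmodSM; rewrite ?g0.
    by apply: eqmodMS.
  apply: eqmodMS => //; apply: eqmodM => //; apply: eqmodD => //.
  by apply: eqmod_sum.
exists b, (G b); split=> //.
have GM : G b * (1 - M0) = 1 + \sum_k (sev kappa (b k) (mu k) - 1).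
  by rewrite -mulrA sevVr// mulr1.
by rewrite -GM mulrBr mulr1 subrK.
Qed.
End Subordination.

(** * Matrix-valued freeness *)

Section CenteredWords.
Variables (K : comNzRingType) (A : algType K).

Lemma nc_polynomialsD (I : Type) (x : I -> A) a b :
  nc_polynomials x a -> nc_polynomials x b -> nc_polynomials x (a + b).
Proof. by move=> [s ->] [t ->]; exists (s ++ t); rewrite big_cat. Qed.

Lemma nc_polynomialsZ (I : Type) (x : I -> A) c a :
  nc_polynomials x a -> nc_polynomials x (c *: a).
Proof.
move=> [s ->]; exists [seq (c * m.1, m.2) | m <- s].
by rewrite big_map scaler_sumr; apply: eq_bigr => m _; rewrite scalerA.
Qed.

Lemma nc_polynomials0 (I : Type) (x : I -> A) : nc_polynomials x 0.
Proof. by exists [::]; rewrite big_nil. Qed.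

Lemma nc_polynomials_sum (I J : Type) (x : I -> A) (r : seq J) (F : J -> A) :
  (forall j, nc_polynomials x (F j)) -> nc_polynomials x (\sum_(j <- r) F j).
Proof.
move=> xF; elim/big_ind: _ => //; first exact: nc_polynomials0.
exact: nc_polynomialsD.
Qed.

Lemma nc_polynomialsX (a : A) n : nc_polynomials (fun _ : unit => a) (a ^+ n).
Proof.
exists [:: (1, nseq n tt)]; rewrite big_seq1 scale1r /monomial.
by rewrite big_nseq; elim: n => [//|n IH]; rewrite exprS iterS -IH.
Qed.

Variables (phi : {scalar A}) (I : Type) (x : I -> A).

Definition centered k y :=
  nc_polynomials (fun _ : unit => x k) y /\ phi y = 0.

(* The span of the alternating words in centered letters starting with a letter
   of index [k]. *)
Inductive centered_words : I -> A -> Prop :=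
| CWord0 k : centered_words k 0
| CWordD k a b : centered_words k a -> centered_words k b -> centered_words k (a + b)
| CWord1 k y : centered k y -> centered_words k y
| CWordM k l y w : k <> l -> centered k y -> centered_words l w ->
    centered_words k (y * w).

Lemma centeredZ k c y : centered k y -> centered k (c *: y).
Proof. by move=> [yx y0]; split; [apply: nc_polynomialsZ|rewrite linearZ /= y0 mulr0]. Qed.

Lemma centered_words_sum k (J : Type) (r : seq J) (F : J -> A) :
  (forall j, centered_words k (F j)) -> centered_words k (\sum_(j <- r) F j).
Proof.
move=> kF; elim/big_ind: _ => //; first exact: CWord0.
by move=> *; apply: CWordD.
Qed.

Hypothesis xfree : freely_independent phi x.

(** Freeness speaks of finite alternating products, whereas [w] unfolds one letter at a time. The
    induction is therefore on the stronger claim that [phi] kills [w] preceded by any alternating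
    product whose last index is not [k]. *)
Lemma free_centered_words k w : centered_words k w -> phi w = 0.
Proof.
pose alt n (i : nat -> I) (y : nat -> A) :=
  (forall a, (a < n)%N -> centered (i a) (y a)) /\
  (forall a, (a.+1 < n)%N -> i a <> i a.+1).
have alt0 n i y : alt n.+1 i y -> phi (\prod_(a < n.+1) y a) = 0.
  move=> [yc ia]; apply: (xfree (i := fun a : 'I_n.+1 => i a)) => //.
  - by move=> a b ab; rewrite ab; apply: ia; rewrite -ab.
  - by move=> a; have [] := yc a (ltn_ord a).
  - by move=> a; have [] := yc a (ltn_ord a).
(* [put] appends an entry at position [n], both to the indices and to the letters of the prefix. *)
pose put T (f : nat -> T) n z a := if (a < n)%N then f a else z.
have altS n i y l z : alt n i y -> centered l z ->
    ((0 < n)%N -> i n.-1 <> l) -> alt n.+1 (put I i n l) (put A y n z).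
  move=> [yc ia] lz il; split=> a; rewrite /put.
    by move=> _; case: ltnP => [/yc|].
  rewrite ltnS => an; rewrite an; have [aSn|aSn] := ltnP a.+1 n; first exact: ia.
  have -> : a = n.-1 by lia.
  by apply: il; lia.
have putE n (y : nat -> A) z :
    \prod_(a < n.+1) put A y n z a = \prod_(a < n) y a * z.
  rewrite big_ord_recr /= /put ltnn; congr (_ * _).
  by apply: eq_bigr => a _; rewrite ltn_ord.
move=> kw; suff: forall n i y, alt n i y -> ((0 < n)%N -> i n.-1 <> k) ->
    phi (\prod_(a < n) y a * w) = 0.
  move=> /(_ 0%N (fun=> k) (fun=> 0)); rewrite big_ord0 mul1r => -> //.
elim: kw => {k w} [k|k a b _ IHa _ IHb|k y ky|k l y w kl ky _ IH] n i z iz ik.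
- by rewrite mulr0 linear0.
- by rewrite mulrDr linearD /= (IHa n i z)// (IHb n i z)// addr0.
- by rewrite -(putE n z y); apply: (alt0 _ (put I i n k)); apply: altS.
- rewrite mulrA -(putE n z y); apply: (IH n.+1 (put I i n k)) => [|_].
    exact: altS.
  by rewrite /put /= ltnn.
Qed.

End CenteredWords.

(** * Ring identities for the linearized resolvent *)

Section FreenessIdentities.
Variable R : pzRingType.

Lemma resolvent_identity (r a g t : R) :
  a * g = 1 -> r * t = 1 -> (1 + (r * a - 1)) * g * t = 1.
Proof. by move=> ag rt; rewrite addrC subrK -(mulrA r) ag mulr1. Qed.

(** Multiply the equation of [V] by [G] on the left. By [g k * b k = G * M k] and the equation of
    [G], the terms in [M0] cancel and each letter enters only through
    [1 - g k * (1 - b k * X k)]. *)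
Lemma subordination_identity (q : nat) (g b M X : 'I_q -> R) (G M0 V e : R) :
  (forall k, b k = G * M k - (g k - 1) * b k) ->
  G = 1 + \sum_k (g k - 1) + G * M0 ->
  V = M0 * V + \sum_k M k * X k * V + e ->
  V = G * e + \sum_k (1 - g k * (1 - b k * X k)) * V.
Proof.
move=> bE GE VE.
have VkE k : (1 - g k * (1 - b k * X k)) * V = G * (M k * X k * V) - (g k - 1) * V.
  have gb : g k * b k = G * M k 
    by apply: (addIr (- ((g k - 1) * b k))); rewrite -bE -mulrBl subKr mul1r.
  rewrite mulrBr mulr1 (mulrA (g k)) gb opprB addrCA mulrDl -!mulrA; congr (_ + _).
  by rewrite -mulNr opprB.
under eq_bigr do rewrite VkE.
rewrite sumrB -mulr_sumr -[X in _ - X]mulr_suml.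
have -> : \sum_k M k * X k * V = V - M0 * V - e.
  by apply/eqP; rewrite eq_sym !subr_eq {1}VE -addrA addrC.
have -> : \sum_k (g k - 1) = G - 1 - G * M0.
  by apply/eqP; rewrite eq_sym !subr_eq {1}GE -addrA addrC.
rewrite !mulrBr !mulrBl mul1r mulrA opprB [_ - _ - G * e]addrAC [X in _ + X]addrA subrK.
by rewrite opprB addrA [G * e + _]addrC subrK addrC subrK.
Qed.

(** With [c] centered, this shows that the [k]-th summand of [subordination_identity] is a centered
    letter times the sum of all the other terms. *)
Lemma remainder_identity (c g t V : R) : (1 + c) * g * t = 1 ->
  (1 - g * t) * V = c * (V - (1 - g * t) * V).
Proof.
move=> cgt; have -> : V - (1 - g * t) * V = g * t * V.
  by rewrite mulrBl mul1r opprB addrC subrK.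
rewrite -[c](addKr 1) [RHS]mulrDl mulN1r [LHS]mulrBl mul1r addrC.
by congr (_ + _); rewrite !mulrA cgt mul1r.
Qed.

End FreenessIdentities.

(** * Expectation of the solution of a linear system in free variables *)

Section MatrixFreeness.
Variables (K : comNzRingType) (A : algType K) (N : nat).
Local Notation B := 'M[K]_N.+1.
Local Notation AM := (algmx A N.+1).

Definition iota_mx (X : B) : AM := map_mx (in_alg A) X.

Fact iota_mx_zmod : zmod_morphism iota_mx.
Proof. by move=> X Y; rewrite /iota_mx map_mxB. Qed.
Fact iota_mx_monoid : monoid_morphism iota_mx.
Proof. by split=> [|X Y]; rewrite /iota_mx ?map_mx1 ?map_mxM. Qed.
HB.instance Definition _ := GRing.isZmodMorphism.Build B AM iota_mx iota_mx_zmod.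
HB.instance Definition _ := GRing.isMonoidMorphism.Build B AM iota_mx iota_mx_monoid.

Definition diag_alg (a : A) : AM := a%:M.

Lemma diag_algX a n : diag_alg (a ^+ n) = diag_alg a ^+ n.
Proof. by rewrite /diag_alg rmorphXn. Qed.

Lemma iota_diag X a i j : (iota_mx X * diag_alg a) i j = X i j *: a.
Proof.
rewrite mxE (bigD1 j)//= !mxE eqxx mulr1n mulr_algl big1 ?addr0// => k kj.
by rewrite !mxE (negPf kj) mulr0n mulr0.
Qed.

Lemma diag_iota X a i j : (diag_alg a * iota_mx X) i j = X i j *: a.
Proof.
rewrite mxE (bigD1 i)//= !mxE eqxx mulr1n mulr_algr big1 ?addr0// => k ki.
by rewrite !mxE eq_sym (negPf ki) mulr0n mul0r.
Qed.

Lemma iota_diagC X a : iota_mx X * diag_alg a = diag_alg a * iota_mx X.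
Proof. by apply/matrixP => i j; rewrite iota_diag diag_iota. Qed.

Lemma mul_iota (Y : AM) X i j : (Y * iota_mx X) i j = \sum_k X k j *: Y i k.
Proof. by rewrite mxE; apply: eq_bigr => k _; rewrite mxE mulr_algr. Qed.

Lemma alg_central (C : algType K) c (y : C) : in_alg C c * y = y * in_alg C c.
Proof. by rewrite mulr_algl mulr_algr. Qed.

Lemma scalar_central c (y : B) : scalar_mx c * y = y * scalar_mx c.
Proof. by rewrite -[LHS]scalar_mxC. Qed.

Lemma scalarM c (Y : B) i j : (scalar_mx c * Y) i j = c * Y i j.
Proof. by rewrite [_ * Y]mul_scalar_mx mxE. Qed.

Variables (phi : {scalar A}) (phi1 : phi 1 = 1) (q : nat) (x : 'I_q -> A).
Hypothesis xfree : freely_independent phi x.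

Local Notation mu := (fun k => Series (fun n => phi (x k ^+ n))).

Section Resolvent.
Variables (k : 'I_q) (b : series B).
Hypothesis b0 : scoef b 0 = 0.
Let beta := smap iota_mx b * sconst (diag_alg (x k)).
Let r := sev (in_alg AM) beta (sgeo K).
Let g := sev (@scalar_mx K N.+1) b (mu k).

Let scoef_r n i j : scoef r n i j = \sum_(l < n.+1) scoef (b ^+ l) n i j *: x k ^+ l.
Proof.
rewrite scoef_sev summxE; apply: eq_bigr => l _.
rewrite (rmorph1 (in_alg AM)) mul1r exprMn_comm; last first.
  by apply: seriesP => m; rewrite scoefMC scoefCM /= iota_diagC.
rewrite -(rmorphXn (smap iota_mx)) -(rmorphXn (@sconst AM)) -diag_algX.
by rewrite scoefMC iota_diag.
Qed.

(** The witness is [(1 - beta)^-1 * g^-1 - 1]. Matrices over [K] commute with [diag_alg (x k)], so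
    [phi] applied entrywise turns the resolvent into [g], and the witness into [g * g^-1 - 1 = 0].
    Both inverses are geometric series. *)
Lemma resolvent_centered : exists c : series AM,
  [/\ scoef c 0 = 0, forall n i j, centered phi x k (scoef c n i j)
    & (1 + c) * smap iota_mx g * (1 - beta) = 1].
Proof.
have mu0 : scoef (mu k) 0 = 1 by rewrite /= expr0.
have beta0 : scoef beta 0 = 0 by rewrite scoef0M /= b0 rmorph0 mul0r.
have g0 : scoef (1 - g) 0 = 0.
  by rewrite scoefD scoefN scoef_sev0 mu0 rmorph1 subrr.
pose ga := sev (@scalar_mx K N.+1) (1 - g) (sgeo K).
have gga : g * ga = 1 by rewrite -[g](subKr 1) sevV//; apply: scalar_central.
have gag : ga * g = 1 by rewrite -[g](subKr 1) sevVr//; apply: scalar_central.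
exists (r * smap iota_mx ga - 1); split.
- have r0 : scoef r 0 = 1 by rewrite scoef_sev0 (rmorph1 (in_alg AM)).
  have ga0 : scoef ga 0 = 1 by rewrite scoef_sev0 rmorph1.
  rewrite scoefD scoefN scoef0M r0 mul1r (_ : scoef _ 0 = iota_mx (scoef ga 0))//.
  by rewrite ga0 rmorph1 subrr.
- move=> n i j.
  have cE : scoef (r * smap iota_mx ga - 1) n i j =
    \sum_(l < n.+1) \sum_m scoef ga (n - l) m j *: scoef r l i m
      - ((n == 0%N) && (i == j))%:R.
    rewrite scoefD scoefN !mxE scoefM summxE; congr (_ - _).
      by apply: eq_bigr => l _; rewrite mul_iota.
    by rewrite scoef1; case: (n == 0%N); rewrite !mxE ?mulr1n ?mulr0n.
  rewrite cE; split.
    apply: nc_polynomialsD; last first.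
      rewrite -scaleN1r -[_%:R]scaler_nat; apply/nc_polynomialsZ.
      by rewrite scaler_nat -scaler_nat; apply/nc_polynomialsZ; apply: (nc_polynomialsX _ 0).
    apply: nc_polynomials_sum => l; apply: nc_polynomials_sum => m.
    apply: nc_polynomialsZ; rewrite scoef_r.
    apply: nc_polynomials_sum => h; apply: nc_polynomialsZ.
    exact: nc_polynomialsX.
  have phir l m : phi (scoef r l i m) = scoef g l i m.
    rewrite scoef_r scoef_sev summxE linear_sum; apply: eq_bigr => h _ /=.
    by rewrite linearZ /= mulrC scalarM.
  have := congr1 (fun f : series B => scoef f n i j) gga.
  rewrite scoefM scoef1 summxE => gE.
  rewrite linearB linear_sum /=.
  under eq_bigr => l _.
    rewrite linear_sum /=.
    under eq_bigr do rewrite linearZ /= phir mulrC.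
    over.
  rewrite (_ : phi _%:R = ((n == 0%N)%:R : B) i j).
    rewrite -gE; apply/eqP; rewrite subr_eq0; apply/eqP.
    by apply: eq_bigr => l _; rewrite mxE.
  by case: (n == 0%N); rewrite mxE; case: (i == j); rewrite ?linear0 ?phi1.
- have gag' : smap iota_mx ga * smap iota_mx g = 1 by rewrite -rmorphM gag rmorph1.
  apply: resolvent_identity => //.
  by apply: sevVr => //; apply: alg_central.
Qed.

End Resolvent.

Local Notation io := (smap iota_mx).

(** [V] splits as [G * e] plus terms [Vk k], where [Vk k] is a centered series in [x k] times
    [G * e] and the [Vk l] with [l != k]. Unfolding this recursion yields alternating centered
    words, which freeness kills. *)
Lemma free_expectation (M0 e G : series B) (M b : 'I_q -> series B) (V : series AM) :
  let g k := sev (@scalar_mx K N.+1) (b k) (mu k) in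
  (forall k, scoef (b k) 0 = 0) ->
  (forall k, b k = G * M k - (g k - 1) * b k) ->
  G = 1 + \sum_k (g k - 1) + G * M0 ->
  V = smap iota_mx M0 * V
      + \sum_k smap iota_mx (M k) * sconst (diag_alg (x k)) * V
      + smap iota_mx e ->
  forall n i j, phi (scoef V n i j) = scoef (G * e) n i j.
Proof.
move=> g b0 bE GE VE.
pose X k := sconst (diag_alg (x k)).
have /choice[c cP] := fun k => @resolvent_centered k (b k) (b0 k).
pose Vk k := (1 - io (g k) * (1 - io (b k) * X k)) * V.
have sumV : V = io (G * e) + \sum_k Vk k.
  rewrite rmorphM; apply: (@subordination_identity _ _ _ _ (io \o M) _ _ (io M0)) => //.
  - by move=> k; rewrite /= {1}(bE k) rmorphB !rmorphM rmorphB rmorph1.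
  - rewrite {1}GE !rmorphD rmorph1 rmorph_sum rmorphM.
    by under eq_bigr do rewrite rmorphB rmorph1.
have Vkc k : Vk k = c k * (V - Vk k).
  by have [_ _ cV] := cP k; apply: remainder_identity.
(* Strong induction on the degree: [c k] has no constant term, so only lower coefficients of the
   other [Vk l] occur. *)
have Vkw n k i j : centered_words phi x k (scoef (Vk k) n i j).
  elim/ltn_ind: n k i j => n IH k i j; have [c0 cc _] := cP k.
  have VVk : V - Vk k = io (G * e) + \sum_(l | l != k) Vk l.
    by rewrite {1}sumV (bigD1 k)//= [Vk k + _]addrC addrA addrK.
  rewrite Vkc scoefM summxE; apply: centered_words_sum => -[[|a] an]; rewrite [nat_of_ord _]/=.
    by rewrite c0 mul0r mxE; apply: CWord0.
  rewrite mxE; apply: centered_words_sum => m.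
  rewrite VVk scoefD scoef_sum mxE summxE mulrDr mulr_sumr; apply: CWordD.
    by rewrite mxE mulr_algr; apply/CWord1/centeredZ/cc.
  elim/big_ind: _ => [|? ?|l /eqP lk]; [exact: CWord0|exact: CWordD|].
  by apply: (CWordM (l := l)) => [|//|]; [exact/nesym|apply: IH; lia].
move=> n i j; rewrite {1}sumV scoefD scoef_sum mxE summxE linearD linear_sum.
rewrite [X in _ + X]big1 => [|k _]; last exact: (free_centered_words xfree (Vkw n k i j)).
rewrite addr0.
by rewrite !mxE linearZ /= phi1 mulr1.
Qed.

End MatrixFreeness.

(** * Derivations and algebraic elements *)

Section Derivations.
Variable S : comNzRingType.
Hypothesis Sdomain : forall f g : S, f * g = 0 -> f = 0 \/ g = 0.
Hypothesis Schar0 : forall (n : nat) (f : S), f *+ n.+1 = 0 -> f = 0.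

Lemma Sdomain_neq0 (f g : S) : f != 0 -> g != 0 -> f * g != 0.
Proof. by move=> /eqP f0 /eqP g0; apply/eqP => /Sdomain[]. Qed.

(** Take a relation of least degree. If its derivative vanished at [a], minimality would make the
    derivative zero, and characteristic 0 would then kill the leading coefficient. *)
Lemma separable_relation (R : comNzRingType) (j : {rmorphism R -> S}) (a : S) :
  (exists2 p : {poly R}, map_poly j p != 0 & (map_poly j p).[a] = 0) ->
  exists m : {poly R}, [/\ map_poly j m != 0, (map_poly j m).[a] = 0,
    (map_poly j m)^`().[a] != 0
    & forall p : {poly R}, map_poly j p != 0 -> (map_poly j p).[a] = 0 ->
        (size (map_poly j m) <= size (map_poly j p))%N].
Proof.
move=> [p0 p00 p0a].
pose Q n := `[< exists p : {poly R},
  [/\ map_poly j p != 0, (map_poly j p).[a] = 0 & size (map_poly j p) = n] >].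
have exQ : exists n, Q n by exists (size (map_poly j p0)); apply/asboolP; exists p0.
case: (ex_minnP exQ) => n /asboolP[m [m0 ma mn]] nmin; exists m.
have min p : map_poly j p != 0 -> (map_poly j p).[a] = 0 ->
    (size (map_poly j m) <= size (map_poly j p))%N.
  by move=> p1 pa; rewrite mn; apply: nmin; apply/asboolP; exists p.
split=> //; apply/eqP => m'a.
have mS : (1 < size (map_poly j m))%N.
  rewrite ltnNge; apply/negP => /size1_polyC mC.
  by move: ma m0; rewrite mC hornerC => ->; rewrite eqxx.
have m'0 : map_poly j m^`() = 0.
  apply/eqP/negPn/negP => m'0; have := min _ m'0.
  rewrite -deriv_map => /(_ m'a); rewrite leqNgt => /negP; apply.
  exact: lt_size_deriv.
have := coef_deriv (map_poly j m) (size (map_poly j m)).-2.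
rewrite deriv_map m'0 coef0 => /esym/Schar0.
rewrite prednK; last by lia.
by move/eqP; rewrite -lead_coefE lead_coef_eq0; apply/negP.
Qed.

(* A derivation on the subring [dj @` dR] of [S], presented on a cover [dR]. *)
Record derivation := Derivation {
  dR : comNzRingType;
  dj : {rmorphism dR -> S};
  dD : dR -> S;
  dB : zmod_morphism dD;
  dM : forall x y, dD (x * y) = dj x * dD y + dj y * dD x;
  dker : forall x, dj x = 0 -> dD x = 0 }.

HB.instance Definition _ P := GRing.isZmodMorphism.Build (dR P) S (@dD P) (@dB P).

(** A relation rather than a function: the value at [x] is read off any preimage of [x] in the
    cover, and [der_inj] shows that the choice does not matter. *)
Definition der P x x' := exists2 r, @dj P r = x & @dD P r = x'.

Lemma der_inj P x x' x'' : der P x x' -> der P x x'' -> x' = x''.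
Proof.
move=> [r rx <-] [t tx <-]; apply/eqP; rewrite -subr_eq0 -dB dker//.
by rewrite rmorphB rx tx subrr.
Qed.

Lemma derD P x x' y y' : der P x x' -> der P y y' -> der P (x + y) (x' + y').
Proof. by move=> [r <- <-] [t <- <-]; exists (r + t); rewrite ?rmorphD ?raddfD. Qed.

Lemma derB P x x' y y' : der P x x' -> der P y y' -> der P (x - y) (x' - y').
Proof. by move=> [r <- <-] [t <- <-]; exists (r - t); rewrite ?rmorphB ?raddfB. Qed.

Lemma derM P x x' y y' : der P x x' -> der P y y' -> der P (x * y) (x * y' + y * x').
Proof. by move=> [r <- <-] [t <- <-]; exists (r * t); rewrite ?rmorphM ?dM. Qed.

Section Adjoin.
Variables (P : derivation) (a sigma v : S).
Local Notation R := (dR P).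
Local Notation J := (map_poly (@dj P)).
Local Notation DD := (map_poly (@dD P)).

Let DDM (p r : {poly R}) : DD (p * r) = J p * DD r + J r * DD p.
Proof.
apply/polyP => n; rewrite coef_map coefM coefD !coefM raddf_sum.
rewrite [X in _ = _ + X](reindex_inj rev_ord_inj) -big_split.
apply: eq_bigr => i _; rewrite !coef_map /= subSS subKn; last by rewrite -ltnS.
exact: dM.
Qed.

Definition adjoin_j : {rmorphism {poly R} -> S} := horner_eval a \o J.

(** The derivation sending [a] to [v] and equal to [sigma] times the old one on coefficients;
    [sigma] replaces the division needed when [a] is algebraic. *)
Definition adjoin_D (p : {poly R}) := sigma * (DD p).[a] + v * (J p)^`().[a].

Lemma adjoin_jE p : adjoin_j p = (J p).[a]. Proof. by []. Qed.

Lemma adjoin_DB : zmod_morphism adjoin_D.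
Proof.
move=> p r; rewrite /adjoin_D !raddfB /= !hornerE.
ring.
Qed.

Lemma adjoin_DM p r :
  adjoin_D (p * r) = adjoin_j p * adjoin_D r + adjoin_j r * adjoin_D p.
Proof.
rewrite !adjoin_jE /adjoin_D DDM rmorphM /= derivM !hornerE; ring.
Qed.

Hypothesis adjoin_ker : forall p, adjoin_j p = 0 -> adjoin_D p = 0.

Definition adjoin := Derivation adjoin_DB adjoin_DM adjoin_ker.

Lemma der_adjoin x x' : der P x x' -> der adjoin x (sigma * x').
Proof.
move=> [r <- <-]; exists r%:P.
  by rewrite [LHS]adjoin_jE map_polyC hornerC.
by rewrite /= /adjoin_D !map_polyC /= derivC horner0 mulr0 addr0 hornerC.
Qed.

Lemma der_adjoinX : der adjoin a v.
Proof.
exists 'X; first by rewrite [LHS]adjoin_jE map_polyX hornerX.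
rewrite /= /adjoin_D map_polyX derivX hornerC mulr1.
rewrite (_ : DD 'X = 0) ?horner0 ?mulr0 ?add0r//.
have D1 : @dD P 1 = 0.
  have /eqP := dM (1 : R) 1; rewrite !mulr1 rmorph1 !mul1r -subr_eq0 opprD addrA subrr.
  by rewrite sub0r oppr_eq0 => /eqP.
apply/polyP => n; rewrite coef_map coefX coef0.
by case: (n == 1%N); rewrite ?D1 ?raddf0.
Qed.

End Adjoin.

Lemma size_lead_cancel (p m : {poly S}) : p != 0 -> m != 0 -> (size m <= size p)%N ->
  (size ((lead_coef m)%:P * p
         - (lead_coef p)%:P * 'X^(size p - size m) * m)%R < size p)%N.
Proof.
rewrite -!size_poly_gt0 => p0 m0 mp.
rewrite -(prednK p0) ltnS; apply/leq_sizeP => i pi.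
rewrite coefB -mulrA !coefCM coefXnM ifN; last by rewrite -leqNgt; lia.
have [->|ip] := eqVneq i (size p).-1.
  rewrite -lead_coefE (_ : _ - _ = (size m).-1)%N; last by lia.
  by rewrite -lead_coefE mulrC subrr.
have {}pi : (size p <= i)%N by rewrite -(prednK p0) ltn_neqAle eq_sym ip.
have pi0 : p`_i = 0 by exact: nth_default.
have mi0 : m`_(i - ((size p).-1.+1 - size m)) = 0.
  by apply: nth_default; rewrite (prednK p0) leq_subRL ?subnK//; apply: leq_trans pi; apply: leq_subr.
by rewrite pi0 mi0 !mulr0 subrr.
Qed.

Lemma der_extend P a : exists P' sigma, [/\ sigma != 0,
  forall x x', der P x x' -> der P' x (sigma * x') & exists v, der P' a v].
Proof.
have [algP|trP] := pselect (exists2 p : {poly dR P},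
    map_poly (@dj P) p != 0 & (map_poly (@dj P) p).[a] = 0).
  have [m [m0 ma m'a mmin]] := separable_relation algP.
  pose J := map_poly (@dj P).
  (* Differentiating [m(a) = 0] gives [(D m)(a) + m'(a) * D a = 0]; after multiplication by
     [sigma = m'(a)] the value at [a] is forced to be this [v]. *)
  pose sigma := (J m)^`().[a]; pose v := - (map_poly (@dD P) m).[a].
  (* Pseudo-division by [m] lowers the degree of [p]. Both maps kill [m], and the multiplier, the
     nonzero leading coefficient of [m], cancels in the domain [S]. *)
  have hk p : adjoin_j P a p = 0 -> adjoin_D a sigma v p = 0.
    have [n] := ubnP (size (J p)); elim: n p => // n IH p pn pa.
    have [Jp0|Jp0] := eqVneq (J p) 0.
      rewrite /adjoin_D -/J Jp0 deriv0 horner0 mulr0 addr0.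
      rewrite (_ : map_poly _ p = 0) ?horner0 ?mulr0//.
      apply/polyP => i; rewrite coef_map coef0 /= dker//.
      by rewrite -[LHS](coef_map (@dj P)) -/J Jp0 coef0.
    have mp : (size (J m) <= size (J p))%N := mmin _ Jp0 pa.
    pose c := m`_(size (J m)).-1; pose d := p`_(size (J p)).-1.
    pose k := (size (J p) - size (J m))%N.
    pose p1 := c%:P * p - d%:P * 'X^k * m.
    have jc : dj P c = lead_coef (J m) by rewrite lead_coefE coef_map.
    have jd : dj P d = lead_coef (J p) by rewrite lead_coefE coef_map.
    have c0 : dj P c != 0 by rewrite jc lead_coef_eq0.
    have ma' : adjoin_j P a m = 0 by [].
    have Dm : adjoin_D a sigma v m = 0.
      by rewrite /adjoin_D -/J -/sigma /v mulrC mulNr subrr.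
    have p1a : adjoin_j P a p1 = 0 by rewrite rmorphB !rmorphM pa ma' !mulr0 subrr.
    have p1n : (size (J p1) < n)%N.
      rewrite /p1 /J rmorphB !rmorphM /= !map_polyC map_polyXn [_ c]jc [_ d]jd -/J.
      apply: leq_trans (pn : (size (J p) <= n)%N).
      exact: size_lead_cancel.
    have /eqP := IH p1 p1n p1a.
    rewrite adjoin_DB !adjoin_DM pa ma' Dm !mul0r !mulr0 !addr0 subr0.
    rewrite adjoin_jE map_polyC hornerC => /eqP/Sdomain[/eqP cc|//].
    by rewrite (negPf c0) in cc.
  exists (adjoin hk), sigma; split=> //; first exact: der_adjoin.
  by exists v; apply: der_adjoinX.
(* In the transcendental case a relation at [a] has only zero coefficients in [S], so the value at
   [a] is free; 0 is chosen. *)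
have hk p : adjoin_j P a p = 0 -> adjoin_D a 1 0 p = 0.
  move=> pa; rewrite /adjoin_D mul0r addr0 mul1r.
  rewrite (_ : map_poly _ p = 0) ?horner0//.
  apply/polyP => i; rewrite coef_map coef0 /= dker//.
  rewrite -[LHS](coef_map (@dj P)); have [->|Jp] := eqVneq (map_poly (@dj P) p) 0.
    by rewrite coef0.
  by case: trP; exists p.
exists (adjoin hk), 1; split; [exact: oner_neq0|exact: der_adjoin|].
by exists 0; apply: der_adjoinX.
Qed.

Lemma der_extend_seq P (s : seq S) : exists P' sigma, [/\ sigma != 0,
  forall x x', der P x x' -> der P' x (sigma * x')
  & forall a, a \in s -> exists v, der P' a v].
Proof.
elim: s => [|a s [P1 [s1 [s1_neq0 derP1 sP1]]]].
  by exists P, 1; split=> [||//]; [exact: oner_neq0|move=> x x'; rewrite mul1r].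
have [P2 [s2 [s2_neq0 derP2 aP2]]] := der_extend P1 a.
exists P2, (s2 * s1); split; first exact: Sdomain_neq0.
  by move=> x x' /derP1/derP2; rewrite mulrA.
move=> b; rewrite inE => /predU1P[->//|/sP1[v /derP2 bv]].
by exists (s2 * v).
Qed.

(** Start from the zero derivation on [R0], give [f] the value 1, which no relation forbids, and
    extend to [s]. The factors accumulated on the way make up [sigma]. *)
Lemma transcendental_der (R0 : comNzRingType) (j0 : {rmorphism R0 -> S})
    (f : S) (s : seq S) :
  (forall p, (map_poly j0 p).[f] = 0 -> p = 0) ->
  exists P sigma, [/\ sigma != 0, der P f sigma, forall c, der P (j0 c) 0
    & forall a, a \in s -> exists v, der P a v].
Proof.
move=> ftr.
have dB0 : zmod_morphism (fun _ : R0 => 0 : S) by move=> x y; rewrite subrr.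
have dM0 (x y : R0) : (0 : S) = j0 x * 0 + j0 y * 0 by rewrite !mulr0 addr0.
pose P0 := Derivation dB0 dM0 (fun _ _ => erefl).
have hk p : adjoin_j P0 f p = 0 -> @adjoin_D P0 f 1 1 p = 0.
  by move=> /ftr ->; have := @adjoin_DB P0 f 1 1 0 0; rewrite !subrr.
have [P [sigma [s0 derP sP]]] := der_extend_seq (adjoin hk) s.
exists P, sigma; split=> // [|c].
  by rewrite -[sigma]mulr1; apply/derP/der_adjoinX.
rewrite -(mulr0 sigma) -[X in sigma * X](mul1r 0); apply/derP/der_adjoin.
by exists c.
Qed.

End Derivations.

(** * Algebraicity of the subordinate solution *)

Inductive generated (K : comNzRingType) (h : series K) : series K -> Prop :=
| GenC c : generated h (sconst c)
| GenX : generated h svar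
| GenH : generated h h
| GenD f g : generated h f -> generated h g -> generated h (f + g)
| GenM f g : generated h f -> generated h g -> generated h (f * g).

(** * Entries of matrix-valued series *)

Section Entries.
Variables (A : nzRingType) (N : nat).
Implicit Types X Y : series 'M[A]_N.+1.

Definition sentry X i j : series A := Series (fun n => scoef X n i j).

Lemma sentryD X Y i j : sentry (X + Y) i j = sentry X i j + sentry Y i j.
Proof. by apply: seriesP => n; rewrite /= mxE. Qed.
Lemma sentryN X i j : sentry (- X) i j = - sentry X i j.
Proof. by apply: seriesP => n; rewrite /= mxE. Qed.
Lemma sentryM X Y i j : sentry (X * Y) i j = \sum_k sentry X i k * sentry Y k j.
Proof.
apply: seriesP => n; rewrite scoef_sum [LHS]summxE.
under eq_bigr do rewrite mxE.
by rewrite exchange_big.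
Qed.
Lemma sentryC (X : 'M[A]_N.+1) i j : sentry (sconst X) i j = sconst (X i j).
Proof. by apply: seriesP => -[|n] //=; rewrite mxE. Qed.
Lemma sentry_sord1 X i j : scoef X 0 = 0 -> sord 1 (sentry X i j).
Proof. by move=> X0 [|]//= _; rewrite X0 mxE. Qed.
End Entries.

(** * Divisibility of derivatives by powers of the variable *)

Section DerivationOrder.
Variables (K : fieldType) (N : nat) (P : derivation (series K)).
Local Notation B := 'M[K]_N.+1.
Hypothesis derC : forall c, der P (sconst c) 0.

(** For [n = 0] this only says that [x] lies in the domain of the derivation. *)
Definition dord n x := exists2 x', der P x x' & sord n x'.

Lemma dord_sum n (I : Type) (r : seq I) (F : I -> series K) :
  (forall i, dord n (F i)) -> dord n (\sum_(i <- r) F i).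
Proof.
move=> Fn; elim/big_ind: _ => //.
  by exists 0 => //; have := derC 0; rewrite rmorph0.
move=> x y [x' xx' x'0] [y' yy' y'0]; exists (x' + y'); first exact: derD.
exact: sordD.
Qed.

Definition mdord n (X : series B) := forall i j, dord n (sentry X i j).

Lemma mdordD n X Y : mdord n X -> mdord n Y -> mdord n (X + Y).
Proof.
move=> Xn Yn i j; have [x' xx' x'0] := Xn i j; have [y' yy' y'0] := Yn i j.
exists (x' + y'); last exact: sordD.
by rewrite sentryD; apply: derD.
Qed.

Lemma mdordC n X : mdord n (sconst X).
Proof. by move=> i j; exists 0 => //; rewrite sentryC; apply: derC. Qed.

Lemma mdordM n X Y : mdord n X -> mdord n Y -> mdord n (X * Y).
Proof.
move=> Xn Yn i j; rewrite sentryM; apply: dord_sum => k.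
have [x' xx' x'0] := Xn i k; have [y' yy' y'0] := Yn k j.
exists (sentry X i k * y' + sentry Y k j * x'); first exact: derM.
by apply: sordD; apply: sordMr.
Qed.

(** In the Leibniz rule the less divisible derivative is multiplied by a factor without constant
    term, which makes up the missing degree. The next two lemmas work likewise. *)
Lemma mdordSM n X Y : scoef X 0 = 0 -> mdord n.+1 X -> mdord n Y ->
  mdord n.+1 (X * Y).
Proof.
move=> X0 Xn Yn i j; rewrite sentryM; apply: dord_sum => k.
have [x' xx' x'0] := Xn i k; have [y' yy' y'0] := Yn k j.
exists (sentry X i k * y' + sentry Y k j * x'); first exact: derM.
apply: sordD; last exact: sordMr.
by rewrite -add1n; apply: sordM => //; apply: sentry_sord1.
Qed.

Lemma mdordMS n X Y : scoef Y 0 = 0 -> mdord n X -> mdord n.+1 Y ->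
  mdord n.+1 (X * Y).
Proof.
move=> Y0 Xn Yn i j; rewrite sentryM; apply: dord_sum => k.
have [x' xx' x'0] := Xn i k; have [y' yy' y'0] := Yn k j.
exists (sentry X i k * y' + sentry Y k j * x'); first exact: derM.
apply: sordD; first exact: sordMr.
by rewrite -add1n; apply: sordM => //; apply: sentry_sord1.
Qed.

Lemma mdordM0 n X Y : scoef X 0 = 0 -> scoef Y 0 = 0 -> mdord n X -> mdord n Y ->
  mdord n.+1 (X * Y).
Proof.
move=> X0 Y0 Xn Yn i j; rewrite sentryM; apply: dord_sum => k.
have [x' xx' x'0] := Xn i k; have [y' yy' y'0] := Yn k j.
exists (sentry X i k * y' + sentry Y k j * x'); first exact: derM.
by apply: sordD; rewrite -add1n; apply: sordM => //; apply: sentry_sord1.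
Qed.

Lemma mdordB n X Y : mdord n X -> mdord n Y -> mdord n (X - Y).
Proof.
move=> Xn Yn i j; have [x' xx' x'0] := Xn i j; have [y' yy' y'0] := Yn i j.
exists (x' - y'); last by apply: sordD => //; apply: sordN.
by rewrite sentryD sentryN; apply: derB.
Qed.

Lemma mdord1 n : mdord n 1.
Proof. by rewrite -(rmorph1 (@sconst B)); apply: mdordC. Qed.

Lemma mdord_sum n (I : Type) (r : seq I) (F : I -> series B) :
  (forall i, mdord n (F i)) -> mdord n (\sum_(i <- r) F i).
Proof.
move=> Fn; elim/big_ind: _ => [|X Y|i _]; last exact: Fn.
  by have := mdordC n 0; rewrite rmorph0.
exact: mdordD.
Qed.

Local Notation ev := (sev (@scalar_mx K N.+1)).

Lemma mdord_generated n b h y : scoef b 0 = 0 -> generated h y ->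
  mdord n b -> mdord n (ev b h) -> mdord n (ev b y).
Proof.
move=> b0 hy bn hn; elim: hy => [c|||f g _ IHf _ IHg|f g _ IHf _ IHg] //.
- by rewrite sevC; apply: mdordC.
- by rewrite sevX.
- by rewrite sevD; apply: mdordD.
- by rewrite sevM//; [apply: mdordM|exact: scalar_central].
Qed.

(** The contracting equations are differentiated: if the derivatives of [G], [b k] and [h k] at
    [b k] are divisible by [svar ^+ n], the equations improve this to [n.+1], first for [b], then
    for [h], then for [G]. *)
Lemma mdord_subordination (q : nat) (mu h q0 q1 : 'I_q -> series K)
    (M0 G : series B) (M b : 'I_q -> series B) :
  (forall k, scoef (mu k) 0 = 1) -> (forall k, scoef (h k) 0 = 0) ->
  (forall k, generated (h k) (mu k)) ->
  (forall k, generated (h k) (q0 k)) -> (forall k, generated (h k) (q1 k)) ->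
  (forall k, h k = svar * q0 k + h k * h k * q1 k) ->
  scoef M0 0 = 0 -> (forall k, scoef (M k) 0 = 0) -> 
  (forall n, mdord n M0) -> (forall n k, mdord n (M k)) ->
  (forall k, scoef (b k) 0 = 0) ->
  (forall k, b k = G * M k - (ev (b k) (mu k) - 1) * b k) ->
  G = 1 + \sum_k (ev (b k) (mu k) - 1) + G * M0 ->
  mdord 0 G -> (forall k, mdord 0 (b k)) -> (forall k, mdord 0 (ev (b k) (h k))) ->
  forall n, mdord n G.
Proof.
move=> mu0 h0 hmu hq0 hq1 hE M00 M0k M0d Md b0 bE GE G0 bd0 hd0 n.
suff [] : [/\ mdord n G, forall k, mdord n (b k) & forall k, mdord n (ev (b k) (h k))] by [].
elim: n => [//|n [Gn bn hn]].
have gn k : mdord n (ev (b k) (mu k) - 1).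
  by apply: mdordB (mdord1 _); apply: mdord_generated (hmu k) _ _.
have g0 k : scoef (ev (b k) (mu k) - 1) 0 = 0.
  by rewrite scoefD scoefN scoef_sev0 mu0 rmorph1 subrr.
have bS k : mdord n.+1 (b k).
  rewrite bE; apply: mdordB; first exact: mdordMS.
  exact: mdordM0.
(* The equation of [h k] is used with the matrix [b k] in place of [svar]; its first term needs the
   improved bound [bS]. *)
have hS k : mdord n.+1 (ev (b k) (h k)).
  have H0 : scoef (ev (b k) (h k)) 0 = 0 by rewrite scoef_sev0 h0 rmorph0.
  rewrite hE sevD !sevM ?sevX//; try exact: scalar_central.
  apply: mdordD.
    by apply: mdordSM => //; apply: mdord_generated (hq0 k) _ _.
  apply: mdordSM; first by rewrite scoef0M H0 mul0r.
    exact: mdordM0.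
  by apply: mdord_generated (hq1 k) _ _.
split=> //; rewrite GE; apply: mdordD; last exact: mdordMS.
apply: mdordD (mdord1 _) _; apply: mdord_sum => k; apply: mdordB (mdord1 _).
exact: mdord_generated (hmu k) _ _.
Qed.

End DerivationOrder.

(** * Contracting equations for algebraic series *)

Section Hensel.
Variable K : numFieldType.

Lemma schar0 n (f : series K) : f *+ n.+1 = 0 -> f = 0.
Proof.
move=> fn; apply: seriesP => k; have := congr1 (fun g => scoef g k) fn.
have -> : scoef (f *+ n.+1) k = scoef f k *+ n.+1.
  by elim: n.+1 => [|m IH]; rewrite ?mulr0n// !mulrS scoefD IH.
by move=> /eqP; rewrite mulrn_eq0 /= => /eqP.
Qed.

Lemma spoly_inj : injective (@spoly K).
Proof. by move=> p r pr; apply/polyP => i; have := congr1 (fun f => scoef f i) pr. Qed.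

Lemma spoly_factor n (p : {poly K}) : sord n (spoly p) ->
  exists r, spoly p = svar ^+ n * spoly r.
Proof.
move=> p0; exists (drop_poly n p); apply: seriesP => k; rewrite scoefXnM.
by case: leqP => [nk|/p0//]; rewrite /= coef_drop_poly subnK.
Qed.

Local Notation J := (map_poly (@spoly K)).

Lemma generated_spoly (h : series K) p : generated h (spoly p).
Proof.
elim/poly_ind: p => [|p c IH]; first by have := GenC h 0; rewrite -spolyC.
rewrite rmorphD rmorphM /= spolyC spolyX; apply: GenD; last exact: GenC.
exact/GenM/GenX.
Qed.

Lemma generated_horner (h x : series K) p : generated h x -> generated h (J p).[x].
Proof.
move=> hx; elim/poly_ind: p => [|p c IH].
  by rewrite rmorph0 horner0; have := generated_spoly h 0; rewrite rmorph0.
rewrite rmorphD rmorphM /= map_polyX map_polyC hornerMXaddC; apply: GenD.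
  exact: GenM.
exact: generated_spoly.
Qed.

Lemma generated_taylor1 (h x y : series K) p : generated h x -> generated h y ->
  exists2 q, generated h q & (J p).[x + y] = (J p).[x] + y * q.
Proof.
move=> hx hy; elim/poly_ind: p => [|p c [q hq IH]].
  exists (spoly 0); first exact: generated_spoly.
  by rewrite !rmorph0 !horner0 mulr0 addr0.
exists ((J p).[x] + q * (x + y)).
  by apply: GenD; [exact: generated_horner|apply: GenM => //; apply: GenD].
by rewrite rmorphD rmorphM /= map_polyX map_polyC !hornerMXaddC IH; ring.
Qed.

Lemma generated_taylor2 (h x y : series K) p : generated h x -> generated h y ->
  exists2 q, generated h q &
    (J p).[x + y] = (J p).[x] + (J p^`()).[x] * y + y * y * q.
Proof.
move=> hx hy; elim/poly_ind: p => [|p c [q hq IH]].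
  exists (spoly 0); first exact: generated_spoly.
  by rewrite deriv0 !rmorph0 !horner0 mulr0 mul0r !addr0.
exists ((J p^`()).[x] + q * (x + y)).
  by apply: GenD; [exact: generated_horner|apply: GenM => //; apply: GenD].
rewrite derivMXaddC !rmorphD !rmorphM /= map_polyX map_polyC.
by rewrite !hornerMXaddC IH !hornerE; ring.
Qed.

(** Hensel's argument. With [e] the order of [m'(mu)], write [mu = x + svar ^+ e * h] for a
    truncation [x], expand [m] at [x] to second order and divide by [svar ^+ (e + e)]: the
    coefficient of [h] then has an invertible constant term. *)
Lemma algebraic_contraction (mu : series K) :
  (exists2 p, p != 0 & (J p).[mu] = 0) ->
  exists h q0 q1, [/\ scoef h 0 = 0, generated h mu,
    generated h q0, generated h q1 & h = svar * q0 + h * h * q1].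
Proof.
move=> [p0 p00 p0mu].
have [|m [m0 mmu m'mu _]] := @separable_relation _ schar0 _ (@spoly K) mu.
  exists p0 => //; rewrite -(rmorph0 (map_poly (@spoly K))) (inj_eq (map_inj_poly _ _))//.
    exact: spoly_inj.
  exact: rmorph0.
set w := (_^`()).[mu] in m'mu.
have [e [we e0]] : exists e, scoef w e != 0 /\ sord e w.
  have exn : exists n, scoef w n != 0.
    apply/not_existsP => hn; move/eqP: m'mu; apply; apply: seriesP => n.
    by apply/eqP/negPn/negP/hn.
  case: (ex_minnP exn) => n hn nmin; exists n; split=> // k kn.
  by apply/eqP/negPn/negP => /nmin; rewrite leqNgt kn.
(* Degree [e] is included in the truncation, so that [h] has no constant term. *)
pose a := \poly_(i < e.+1) scoef mu i; pose x := spoly a.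
have /sord_XnM[t mut] : sord e.+1 (mu - x).
  by move=> k kn; rewrite scoefD scoefN /= coef_poly kn subrr.
pose h := svar * t.
have h0 : scoef h 0 = 0 by rewrite scoefXM.
pose y := svar ^+ e * h.
have muE : mu = x + y by rewrite /y /h mulrA -exprSr -mut addrC subrK.
have hx : generated h x by apply: generated_spoly.
have hy : generated h y.
  apply: GenM; last exact: GenH.
  by rewrite -spolyX -rmorphXn; apply: generated_spoly.
have hornx p : (J p).[x] = spoly p.[a] by rewrite horner_map.
have [q hq m2] := generated_taylor2 m hx hy.
have [q' _ m1] := generated_taylor1 m^`() hx hy.
rewrite -muE mmu hornx hornx in m2.
rewrite -muE hornx -deriv_map -/w in m1.
set A := m.[a] in m2; set A' := m^`().[a] in m1 m2.
have A'E : spoly A' = w - svar ^+ e * (h * q') by rewrite m1 /y mulrA addrK.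
(* [A'] agrees with [w] modulo [svar ^+ e.+1], so its order is exactly [e]. *)
have [W WE] : exists W, spoly A' = svar ^+ e * spoly W.
  apply: spoly_factor; rewrite A'E; apply: sordD => //; apply: sordN.
  by apply: sordMl; rewrite -[svar ^+ e]mul1r => k ke; rewrite mul1r scoefXn ltn_eqF.
have W0 : W`_0 = scoef w e.
  have := congr1 (fun f => scoef f e) WE; rewrite A'E scoefD scoefN !scoefXnM leqnn.
  by rewrite subnn scoef0M h0 mul0r subr0 => ->.
have [W1 W1E] : exists W1, spoly W = sconst W`_0 + svar * spoly W1.
  have [|W1 W1E] := @spoly_factor 1 (W - (W`_0)%:P).
    by move=> [|]//= _; rewrite coefB coefC subrr.
  by exists W1; rewrite -spolyC -[svar]expr1 -W1E rmorphB addrC subrK.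
(* In [m2] all terms but [A] contain [svar ^+ (e + e)] and a factor [h]. *)
have [V VE] : exists V, spoly A = svar ^+ e * (svar ^+ e * (svar * spoly V)).
  have [|V VE] := @spoly_factor (e + e + 1) A.
    have -> : spoly A = - (svar ^+ (e + e) * (h * (spoly W + h * q))).
      apply/eqP; rewrite -subr_eq0 m2 WE /y exprD; apply/eqP; ring.
    apply: sordN; apply: sordM; first by move=> k ke; rewrite scoefXn ltn_eqF.
    by apply/sord1P; rewrite scoef0M h0 mul0r.
  by exists V; rewrite VE !exprD expr1 !mulrA.
have {}m2 : svar * spoly V + spoly W * h + h * h * q = 0.
  apply: (@svarX_lreg _ e); apply: (@svarX_lreg _ e).
  by rewrite !mulr0 [RHS]m2 VE WE /y; ring.
(* This constant turns the term [W_0 * h] of [m2] into [- h], and [m2] is then solved for [h]. *)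
pose c := sconst (- (W`_0)^-1).
exists h, (c * (spoly V + spoly W1 * h)), (c * q); split=> //.
- by rewrite muE; apply: GenD.
- apply: GenM; first exact: GenC.
  apply: GenD; first exact: generated_spoly.
  by apply: GenM; [exact: generated_spoly|exact: GenH].
- by apply: GenM => //; apply: GenC.
have cW : c * sconst W`_0 = - 1.
  by rewrite -rmorphM mulNr mulVf ?W0// rmorphN rmorph1.
have E : c * (svar * spoly V + spoly W * h + h * h * q) = 0 by rewrite m2 mulr0.
rewrite W1E in E; apply/eqP; rewrite -subr_eq0; apply/eqP.
transitivity ((c * sconst W`_0 + 1) * h - 0); last by rewrite cW addNr mul0r subr0.
by rewrite -E; ring.
Qed.

End Hensel.

(** * Linearization *)

Section Linearization.
Variables (K : comNzRingType) (A : algType K) (q : nat) (x : 'I_q -> A).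

Lemma bounded_words (I : finType) (X : I -> A) :
  (forall i, nc_polynomials x (X i)) ->
  exists d (c : I -> d.-bseq 'I_q -> K),
    forall i, X i = \sum_w c i w *: monomial x w.
Proof.
move=> /choice[s sX]; pose d := (\sum_i \sum_(m <- s i) size m.2)%N.
exists d, (fun i (w : d.-bseq 'I_q) => \sum_(m <- s i | m.2 == w) m.1) => i.
under eq_bigr do rewrite scaler_suml.
rewrite sX (exchange_big_dep xpredT) //= !big_seq; apply: eq_bigr => m ms.
have md : (size m.2 <= d)%N.
  rewrite /d (bigD1 i)//= (big_rem m ms) /=.
  by apply: leq_trans (leq_addr _ _); apply: leq_addr.
rewrite (big_pred1 (Bseq md)) // => w; by rewrite -val_eqE eq_sym.
Qed.

Variables (p : nat) (X : algmx A p.+1) (d : nat).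
Variable c : 'I_p.+1 -> 'I_p.+1 -> d.-bseq 'I_q -> K.
Hypothesis cX : forall i j, X i j = \sum_w c i j w *: monomial x w.

Local Notation T := ('I_p.+1 * d.-bseq 'I_q)%type.

(** The coefficients of the inverse of [1 - s ^ (d + 1) * X]. The exponent provides one factor [s]
    for each of at most [d] letters and at least one more for the choice of a word. *)
Definition spread_powers n : algmx A p.+1 :=
  if (d.+1 %| n)%N then X ^+ (n %/ d.+1) else 0.

Lemma spread_powersE n : spread_powers n =
  (n == 0%N)%:R + (if (d.+1 <= n)%N then X * spread_powers (n - d.+1) else 0).
Proof.
rewrite /spread_powers; case: (ltnP d n) => [dn|nd].
  rewrite (_ : (n == 0)%N = false) ?add0r; last by apply/eqP; lia.
  rewrite -{1 2}(subnK dn) dvdn_addl// divnDr//.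
  by rewrite divnn addn1; case: ifP; rewrite ?mulr0// exprS.
rewrite addr0; have [->|n0] := eqVneq n 0%N; first by rewrite dvdn0 div0n expr0.
by rewrite gtnNdvd//; lia.
Qed.

(* The state [(i, w)] stands for the row [i] of the resolvent multiplied by the
   word [w] still to be read. *)
Definition state_value (a b : T) n : A :=
  if (size a.2 <= n)%N && nilp b.2
  then monomial x a.2 * spread_powers (n - size a.2) a.1 b.1 else 0.

(** Reading the word [b.2] later costs [size b.2]; the exponent [n] completes this to [d.+1] and is
    positive because words have length at most [d]. *)
Definition restart (a b : T) n : K :=
  if nilp a.2 && (n + size b.2 == d.+1)%N then c a.1 b.1 b.2 else 0.

Definition read_letter k (a b : T) n : K :=
  ((n == 1%N) && (a.1 == b.1) && (a.2 == k :: b.2 :> seq _))%:R.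

Definition final (a b : T) n : K := ((n == 0%N) && (a == b) && nilp a.2)%:R.

(** First-step decomposition: from the empty word, either stop or expand one factor [X]; otherwise
    read the first letter. *)
Lemma state_valueE a b n : state_value a b n =
  \sum_e \sum_(m < n.+1) restart a e m *: state_value e b (n - m)
  + \sum_k \sum_e \sum_(m < n.+1) read_letter k a e m *: (x k * state_value e b (n - m))
  + final a b n *: 1.
Proof.
case: a => i [[|k w] wd].
  have -> : \sum_k \sum_e \sum_(m < n.+1)
      read_letter k (i, Bseq wd) e m *: (x k * state_value e b (n - m)) = 0.
    apply: big1 => k _; apply: big1 => e _; apply: big1 => m _.
    by rewrite /read_letter /= andbF scale0r.
  rewrite addr0; case: b => j [[|l v] vd]; last first.
    have -> : final (i, Bseq wd) (j, Bseq vd) n = 0.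
      by rewrite /final (_ : (_ == _ :> T) = false) ?andbF//; apply/eqP => -[].
    rewrite scale0r addr0 /state_value /= big1 // => e _.
    by rewrite big1 // => m _; rewrite andbF scaler0.
  rewrite {1}/state_value /= /monomial big_nil mul1r subn0 spread_powersE mxE addrC.
  congr (_ + _); last first.
    rewrite /final (_ : (_ == _ :> T) = (i == j)); last first.
      by apply/eqP/eqP => [[]//|->]; congr (_, _); apply: val_inj.
    rewrite andbT; case: (n == 0%N) => /=; rewrite mxE; last by rewrite scale0r.
    by case: (i == j); rewrite ?scale1r ?scale0r.
  have eE e : \sum_(m < n.+1) restart (i, Bseq wd) e m *: state_value e (j, Bseq vd) (n - m)
    = if (d.+1 <= n)%N then
        c i e.1 e.2 *: monomial x e.2 * spread_powers (n - d.+1) e.1 j else 0.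
    have ed : (size e.2 <= d)%N := size_bseq e.2.
    rewrite /restart /state_value /=.
    case: (ltnP d n) => dn; last first.
      apply: big1 => m _; case: eqP => me; last by rewrite scale0r.
      rewrite andbT ifN ?scaler0// -ltnNge; have := ltn_ord m; lia.
    have mP : (d.+1 - size e.2 < n.+1)%N by lia.
    rewrite (bigD1 (Ordinal mP))//= subnK ?eqxx; last by lia.
    rewrite big1 ?addr0 => [|m]; last first.
      rewrite -val_eqE /= => /eqP me; case: eqP => [?|_]; last by rewrite scale0r.
      by case: me; lia.
    rewrite ifT; last by rewrite andbT; lia.
    by rewrite -scalerAl; congr (_ *: (_ * spread_powers _ _ _)); lia.
  under eq_bigr do rewrite eE.
  case: (d.+1 <= n)%N; last by rewrite mxE big1.
  rewrite -(pair_bigA _ (fun j' w => c i j' w *: monomial x w * spread_powers (n - d.+1) j' j)).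
  rewrite mxE; apply: eq_bigr => j' _.
  by rewrite cX mulr_suml.
rewrite [X in _ = X + _ + _]big1 ?add0r => [|e _]; last first.
  by rewrite big1// => m _; rewrite scale0r.
have wd' : (size w <= d)%N by rewrite ltnW.
rewrite /final /= andbF scale0r addr0 (bigD1 k)//=.
rewrite [X in _ + X]big1 ?addr0 => [|k' k'k]; last first.
  apply: big1 => e _; apply: big1 => m _.
  by rewrite /read_letter /= eqseq_cons [k == _]eq_sym (negPf k'k) /= andbF scale0r.
rewrite (bigD1 (i, Bseq wd'))//= [X in _ + X]big1 ?addr0 => [|[i' w']]; last first.
  rewrite xpair_eqE -(val_eqE w') /= => ei; apply: big1 => m _.
  rewrite /read_letter /= eqseq_cons eqxx /=.
  rewrite -andbA [i == _]eq_sym [w == _]eq_sym (negPf ei) andbF scale0r//.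
case: n => [|n].
  by rewrite big_ord1 /read_letter /= scale0r.
rewrite big_ord_recl /read_letter /= scale0r add0r big_ord_recl /= !eqxx scale1r.
rewrite big1 ?addr0 => [|m _]; last by rewrite scale0r.
rewrite subn1 /state_value /=.
by case: ifP => _; rewrite ?mulr0// mulrA /monomial big_cons subSS.
Qed.

Definition poly_entries N (Y : series 'M[K]_N.+1) :=
  forall i j, exists r, sentry Y i j = spoly r.

(** The states are enumerated as matrix indices; [idx i] is row [i] with no word left to read. *)
Lemma linearization : exists N (idx : 'I_p.+1 -> 'I_N.+1)
    (M0 e : series 'M[K]_N.+1) (M : 'I_q -> series 'M[K]_N.+1)
    (V : series (algmx A N.+1)),
  [/\ V = smap (@iota_mx K A N) M0 * V
          + \sum_k smap (@iota_mx K A N) (M k) * sconst (diag_alg N (x k)) * V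
          + smap (@iota_mx K A N) e,
      scoef M0 0 = 0, forall k, scoef (M k) 0 = 0,
      [/\ poly_entries M0, poly_entries e & forall k, poly_entries (M k)]
    & forall n i, scoef V n (idx i) (idx i) = spread_powers n i i].
Proof.
have [N EN] : exists N, N.+1 = #|{: T}|.
  by exists #|{: T}|.-1; rewrite prednK//; apply/card_gt0P; exists (ord0, [bseq]).
pose dec (a : 'I_N.+1) : T := enum_val (cast_ord EN a).
pose enc (t : T) := cast_ord (esym EN) (enum_rank t).
have encK : cancel enc dec by move=> t; rewrite /dec /enc cast_ordKV enum_rankK.
have decK : cancel dec enc by move=> a; rewrite /dec /enc enum_valK cast_ordK.
have decB : bijective dec by exists enc.
pose mx (F : T -> T -> nat -> K) := Series (fun n => \matrix_(a < N.+1, b < N.+1) F (dec a) (dec b) n).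
pose V : series (algmx A N.+1) := Series (fun n => (\matrix_(a < N.+1, b < N.+1) state_value (dec a) (dec b) n) : algmx A N.+1).
have mxV F (U : series (algmx A N.+1)) n a b :
    scoef (smap (@iota_mx K A N) (mx F) * U) n a b =
    \sum_t \sum_(m < n.+1) F (dec a) t m *: scoef U (n - m) (enc t) b.
  rewrite scoefM summxE [RHS]exchange_big; apply: eq_bigr => m _.
  rewrite mxE [RHS](reindex dec); last exact: onW_bij.
  by apply: eq_bigr => l _; rewrite !mxE decK mulr_algl.
have mxpoly F D : (forall a b n, (D <= n)%N -> F a b n = 0) -> poly_entries (mx F).
  move=> F0 a b; exists (\poly_(n < D) F (dec a) (dec b) n).
  apply: seriesP => n; rewrite /= mxE coef_poly.
  by case: ltnP => // Dn; rewrite F0.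
exists N, (fun i => enc (i, [bseq])), (mx restart), (mx final), (fun k => mx (read_letter k)), V.
split.
- apply: seriesP => n; apply/matrixP => a b.
  rewrite [LHS]mxE state_valueE !scoefD !mxE mxV scoef_sum summxE.
  congr (_ + _ + _).
    by apply: eq_bigr => t _; apply: eq_bigr => m _; rewrite mxE encK.
  apply: eq_bigr => k _; rewrite -mulrA mxV; apply: eq_bigr => t _.
  apply: eq_bigr => m _; rewrite scoefCM.
  by rewrite [_ * scoef V _]mul_scalar_mx !mxE encK.
- apply/matrixP => a b; rewrite !mxE /restart add0n.
  case: eqP => [bd|_]; last by rewrite andbF.
  by have := size_bseq (dec b).2; rewrite bd ltnn.
- by move=> k; apply/matrixP => a b; rewrite !mxE.
- split.
  + apply: (@mxpoly _ d.+2) => a b n dn; rewrite /restart.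
    by case: eqP => [|_]; [lia|rewrite andbF].
  + by apply: (@mxpoly _ 1%N) => a b [|n].
  + by move=> k; apply: (@mxpoly _ 2%N) => a b [|[|n]].
- move=> n i; rewrite mxE encK /state_value /= /monomial big_nil mul1r subn0.
  by [].
Qed.

End Linearization.

(** * Laurent series in [1/z] and power series in [s] *)

Section Theta.
Variable K : comNzRingType.

Definition theta_coef (f : series K) (i : int) : K :=
  if i <= 0 then scoef f `|i|%N else 0.

Fact theta_subproof f : `[< bounded_above (theta_coef f) >].
Proof. by apply/asboolP; exists 0 => i i0; rewrite /theta_coef leNgt i0. Qed.

(* Substitution of [1/z] for [s]. *)
Definition theta f := Laurent (theta_subproof f).

Lemma theta_inj : injective theta.
Proof.
move=> f g fg; apply: seriesP => n.
have := congr1 (fun h => lcoef h (- n%:Z)) fg.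
by rewrite /= /theta_coef oppr_le0 lez_nat /= abszN absz_nat.
Qed.

Fact theta_zmod : zmod_morphism theta.
Proof.
move=> f g; apply: laurentP => i; rewrite /= /theta_coef.
by case: ifP => // _; rewrite subr0.
Qed.

Fact theta_monoid : monoid_morphism theta.
Proof.
split=> [|f g]; apply: laurentP => i.
  rewrite /= /theta_coef; case: ifP => [_|]; first by rewrite scoef1 absz_eq0.
  by case: eqP => // ->.
have t0 (h : series K) (j : int) : 0%N%:Z < j -> theta_coef h j = 0.
  by move=> j0; rewrite /theta_coef leNgt j0.
case: (leP i 0) => [i0|i0]; last first.
  by rewrite /= t0// (@lmul_coef_eq0 _ _ _ 0 0)//; apply: t0.
have [m ->] : exists m : nat, i = - m%:Z by exists `|i|%N; lia.
rewrite [RHS](@lmul_coefE _ m _ _ _ 0); [|exact: t0|exact: t0|lia].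
rewrite /= /theta_coef oppr_le0 /= abszN absz_nat.
rewrite /window big_map -[iota 0 _]/(index_iota 0 m.*2.+1).
rewrite (@big_cat_nat _ _ _ m.+1)//=; last by lia.
rewrite [X in _ = _ + X]big_nat [X in _ = _ + X]big1 ?addr0 => [|k km]; last first.
  by rewrite ifN ?mul0r//; lia.
rewrite big_mkord (reindex_inj rev_ord_inj) /=; apply: eq_bigr => k _.
have km : (k <= m)%N by rewrite -ltnS.
rewrite !ifT; [|lia|lia].
by congr (scoef f _ * scoef g _); lia.
Qed.

HB.instance Definition _ := GRing.isZmodMorphism.Build (series K) (laurent K) theta theta_zmod.
HB.instance Definition _ := GRing.isMonoidMorphism.Build (series K) (laurent K) theta theta_monoid.

Lemma thetaC c : theta (spoly c%:P) = laurent_of_poly c%:P.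
Proof.
apply: laurentP => -[[|n]|n]; rewrite /= /theta_coef /= ?coefC//=.
Qed.

Lemma thetaX : laurent_of_poly 'X * theta (spoly 'X) = 1 :> laurent K.
Proof.
apply: laurentP => n; rewrite [LHS]/=.
rewrite (@lmul_coefE _ (`|n| + 1)%N _ _ _ 1); last first.
- by lia.
- by move=> i i1; rewrite /= /theta_coef ifN//; lia.
- by case=> [m|//] m1; rewrite /= coefX; case: eqP => // ?; lia.
have wu : uniq (window (`|n| + 1)).
  by rewrite map_inj_uniq ?iota_uniq// => a b; lia.
rewrite (bigD1_seq 1)//=; last by rewrite mem_window; lia.
rewrite big1 => [|i i1]; last first.
  case: i i1 => [i|i] i1; rewrite /= ?mul0r// coefX.
  by rewrite (_ : (i == 1)%N = false) ?mul0r//; apply/eqP; lia.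
rewrite addr0 coefX mul1r /theta_coef; have [->|n0] := eqVneq n 0.
  by rewrite /= coefX.
case: ifP => n1 //; rewrite [scoef _ _]coefX (_ : (_ == 1)%N = false)//; apply/eqP; lia.
Qed.

Lemma stieltjes_theta (mu : {poly K} -> K) :
  stieltjes mu = theta (svar * Series (fun n => mu 'X^n)).
Proof.
apply: laurentP => i; rewrite [RHS]/(theta_coef _ _) /theta_coef scoefXM.
by case: i => [[|n]|n].
Qed.

End Theta.

(** * Exchange of [z] and [1/z] in polynomial relations *)

Section Reversal.
Variables (K R : comNzRingType) (j1 j2 : {rmorphism {poly K} -> R}).
Hypothesis jC : forall c, j2 c%:P = j1 c%:P.
Hypothesis jX : j1 'X * j2 'X = 1.

Definition poly_reversal n (p : {poly K}) := \poly_(k < n.+1) p`_(n - k).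

Lemma rmorph_poly_wide (j : {rmorphism {poly K} -> R}) n (p : {poly K}) :
  (size p <= n)%N -> j p = \sum_(k < n) j (p`_k)%:P * j 'X ^+ k.
Proof.
move=> pn; rewrite -{1}(coefK p) poly_def rmorph_sum.
have jp k : j (p`_k *: 'X^k) = j (p`_k)%:P * j 'X ^+ k.
  by rewrite -mul_polyC rmorphM rmorphXn.
under eq_bigr do rewrite jp.
rewrite (big_ord_widen _ (fun k => j (p`_k)%:P * j 'X ^+ k) pn) big_mkcond.
apply: eq_bigr => k _; case: ifP => // kp.
by rewrite nth_default ?rmorph0 ?mul0r// leqNgt kp.
Qed.

Lemma poly_reversalE n (p : {poly K}) : (size p <= n.+1)%N ->
  j2 (poly_reversal n p) = j2 'X ^+ n * j1 p.
Proof.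
move=> pn; rewrite (rmorph_poly_wide j2 (size_poly _ _)) (rmorph_poly_wide j1 pn).
rewrite mulr_sumr (reindex_inj rev_ord_inj); apply: eq_bigr => k _.
have kn : (k <= n)%N by rewrite -ltnS.
rewrite /= subSS coef_poly ltnS leq_subr subKn// jC.
have -> : j2 'X ^+ n = j2 'X ^+ (n - k) * j2 'X ^+ k by rewrite -exprD subnK.
rewrite mulrCA -[_ * j2 'X ^+ k * _]mulrA -exprMn [j2 'X * _]mulrC jX expr1n mulr1.
by rewrite mulrC.
Qed.

(** Multiplying the relation by a large power of [1/z] makes its coefficients polynomials in [1/z];
    the extra ['X^i] compensates for replacing [y] by [z * y]. *)
Lemma reverse_relation (P : {poly {poly K}}) y :
  P != 0 -> (map_poly j1 P).[y] = 0 ->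
  exists2 Q : {poly {poly K}}, Q != 0 & (map_poly j2 Q).[j1 'X * y] = 0.
Proof.
move=> P0 Py; pose n := \max_(i < size P) size (P`_i)%R.
have sn i : (size (P`_i)%R <= n.+1)%N.
  have [iP|iP] := ltnP i (size P); last by rewrite nth_default// size_poly0.
  by apply/leqW/(leq_bigmax (Ordinal iP)).
exists (\poly_(i < size P) (poly_reversal n P`_i * 'X^i)).
  have : lead_coef P != 0 by rewrite lead_coef_eq0.
  rewrite lead_coefE; apply: contra => /eqP QE.
  have := congr1 (fun Q : {poly {poly K}} => Q`_(size P).-1) QE.
  rewrite coef_poly prednK ?size_poly_gt0// leqnn coef0.
  move=> pX0; apply/eqP/polyP => k; rewrite coef0.
  have [nk|kn] := ltnP n k; first by rewrite nth_default//; apply: leq_trans nk.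
  have /= := congr1 (fun r : {poly K} => r`_((n - k) + (size P).-1)) pX0.
  by rewrite coefMXn ltnNge leq_addl/= addnK coef_poly ltnS leq_subr subKn ?coef0.
rewrite -(mulr0 (j2 'X ^+ n)) -Py (@horner_coef_wide _ (size P)); last first.
  exact: leq_trans (size_poly _ _) (size_poly _ _).
rewrite (@horner_coef_wide _ (size P)) ?size_poly// mulr_sumr.
apply: eq_bigr => i _; rewrite !coef_map coef_poly ltn_ord /= rmorphM rmorphXn.
rewrite poly_reversalE// exprMn -!mulrA; congr (_ * (_ * _)).
by rewrite mulrA -exprMn mulrC [j2 _ * _]mulrC jX expr1n mulr1.
Qed.

End Reversal.

(** * Algebraicity of the law of a matrix polynomial *)

Section AlgebraicSeries.
Variable K : numFieldType.

(** The transform is [1/z] times the moment series at [1/z]; each direction is [reverse_relation],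
    with the roles of [z] and [1/z] exchanged. *)
Lemma algebraic_stieltjes (mu : {poly K} -> K) :
  algebraic (stieltjes mu) <->
  (exists2 p, p != 0 & (map_poly (@spoly K) p).[Series (fun n => mu 'X^n)] = 0).
Proof.
pose ts : {rmorphism {poly K} -> laurent K} := @theta K \o @spoly K.
set t := Series _; have tE : stieltjes mu = theta (spoly 'X) * theta t.
  by rewrite stieltjes_theta rmorphM spolyX.
have tsE (p : {poly {poly K}}) : (map_poly ts p).[theta t] = theta (map_poly (@spoly K) p).[t].
  by rewrite /ts map_poly_comp horner_map.
split=> [[P P0 Py]|[P P0 Py]].
  have [Q Q0] := reverse_relation (j1 := @laurent_of_poly K) (j2 := ts) (@thetaC K) (thetaX K) P0 Py.
  rewrite tE mulrA thetaX mul1r tsE => Qt; exists Q => //.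
  by apply: theta_inj; rewrite rmorph0.
have jX : ts 'X * laurent_of_poly 'X = 1 by rewrite mulrC; apply: thetaX.
have [Q Q0 Qy] : exists2 Q : {poly {poly K}}, Q != 0 &
    (map_poly (@laurent_of_poly K) Q).[ts 'X * theta t] = 0.
  apply: (reverse_relation _ jX P0) => [c|]; first by rewrite [RHS]thetaC.
  by rewrite tsE Py rmorph0.
by exists Q => //; rewrite tE.
Qed.

Variable d : nat.
Local Notation sigma := (sev (idfun : {rmorphism K -> K}) (svar ^+ d.+1)).
Definition spread_poly : {rmorphism {poly K} -> series K} :=
  horner_eval (svar ^+ d.+1) \o map_poly (@sconst K).

Lemma scoef_spread h n :
  scoef (sigma h) n = if (d.+1 %| n)%N then scoef h (n %/ d.+1) else 0.
Proof.
rewrite scoef_sev; under eq_bigr do rewrite -exprM scoefXn /=.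
case: ifP => [/dvdnP[k ->]|dn].
  have kP : (k < (k * d.+1).+1)%N by rewrite ltnS leq_pmulr.
  rewrite (bigD1 (Ordinal kP))//= [X in _ + X]big1 => [|i]; last first.
    by rewrite -val_eqE /= [(d.+1 * i)%N]mulnC eqn_pmul2r// eq_sym => /negPf ->; rewrite mulr0.
  by rewrite addr0 mulnK// [(d.+1 * k)%N]mulnC eqxx mulr1.
apply: big1 => i _; case: eqP => [ni|_]; last by rewrite mulr0.
by rewrite ni dvdn_mulr in dn.
Qed.

(** Substituting [svar ^+ d.+1] is multiplicative and injective: coefficient [n] reappears in degree
    [n * d.+1]. *)
Lemma spread_relation (P : {poly {poly K}}) t :
  (map_poly spread_poly P).[sigma t] = 0 -> (map_poly (@spoly K) P).[t] = 0.
Proof.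
have cen (c y : K) : idfun c * y = y * idfun c by rewrite mulrC.
have v0 : scoef (svar ^+ d.+1 : series K) 0 = 0 by rewrite scoefXn.
have sp p : spread_poly p = sigma (spoly p).
  elim/poly_ind: p => [|p c IH].
    by rewrite !rmorph0; apply: seriesP => n; rewrite scoef_spread; case: ifP.
  have -> : spoly (p * 'X + c%:P) = spoly p * svar + sconst c.
    by rewrite rmorphD rmorphM /= spolyX spolyC.
  rewrite sevD sevM// -IH sevX// sevC rmorphD rmorphM; congr (_ * _ + _).
    by rewrite /spread_poly /= map_polyX /horner_eval hornerX.
  by rewrite /spread_poly /= map_polyC /horner_eval hornerC.
have -> : (map_poly spread_poly P).[sigma t] = sigma (map_poly (@spoly K) P).[t].
  elim/poly_ind: P => [|P c IH].
    by rewrite !rmorph0 !horner0; apply: seriesP => n; rewrite scoef_spread; case: ifP.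
  rewrite !rmorphD !rmorphM /= !map_polyX !map_polyC !hornerMXaddC IH.
  by rewrite sevD sevM// [_ c]sp.
move=> s0; apply: seriesP => n.
have := congr1 (fun h => scoef h (n * d.+1)%N) s0.
by rewrite scoef_spread dvdn_mull// mulnK.
Qed.

End AlgebraicSeries.

Lemma algebraic_law_matrix (K : numFieldType) (A : algType K) (phi : {scalar A})
    (phi1 : phi 1 = 1) (q p : nat) (x : 'I_q -> A) (xfree : freely_independent phi x)
    (X : algmx A p.+1) :
  (forall i j, nc_polynomials x (X i j)) ->
  (forall i, algebraic_law (law phi (x i))) ->
  algebraic_law (law (mxstate phi p) X).
Proof.
move=> Xx xalg.
have lawS (B : algType K) (psi : {scalar B}) (y : B) :
    Series (fun n => law psi y 'X^n) = Series (fun n => psi (y ^+ n)).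
  by apply: seriesP => n; rewrite /= lawXn.
pose mu k := Series (fun n => phi (x k ^+ n)).
have muE k : exists h : series K * series K * series K,
    [/\ scoef h.1.1 0 = 0, generated h.1.1 (mu k), generated h.1.1 h.1.2,
    generated h.1.1 h.2 & h.1.1 = svar * h.1.2 + h.1.1 * h.1.1 * h.2].
  have [|h [q0 [q1 hP]]] := @algebraic_contraction K (mu k); last by exists (h, q0, q1).
  by rewrite /mu -lawS; apply/algebraic_stieltjes/xalg.
have {muE}[h hP] := choice muE.
have [d [c cX]] := @bounded_words K A q x _ (fun ij => X ij.1 ij.2) (fun ij => Xx ij.1 ij.2).
have [N [idx [M0 [e [M [V [VE M00 Mk0 [M0p ep Mp] Vidx]]]]]]] :=
  @linearization K A q x p X d (fun i j => c (i, j)) (fun i j => cX (i, j)).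
have mu0 k : scoef (mu k) 0 = 1 by rewrite /= expr0 phi1.
have [b [G [b0 bE GE]]] := subordination (@scalar_central K N) mu0 M00 Mk0.
have VG := free_expectation phi1 xfree b0 bE GE VE.
pose t := Series (fun n => mxstate phi p (X ^+ n)).
pose f := sev (idfun : {rmorphism K -> K}) (svar ^+ d.+1) t.
(* The diagonal entries of [V] at [idx i] carry those of the powers of [X], and [VG] gives their
   expectations. *)
have fE : f = sconst (p.+1%:R^-1) * \sum_i sentry (G * e) (idx i) (idx i).
  apply: seriesP => n; rewrite scoefCM scoef_spread scoef_sum /=.
  rewrite -[in RHS](eq_bigr _ (fun i _ => VG n (idx i) (idx i))).
  under [in RHS]eq_bigr do rewrite Vidx.
  rewrite /spread_powers; case: ifP => // _.
  by rewrite big1 ?mulr0// => i _; rewrite mxE linear0.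
suff [P P0 Pf] : exists2 P : {poly {poly K}}, P != 0 & (map_poly (spread_poly K d) P).[f] = 0.
  by apply/algebraic_stieltjes; exists P => //; rewrite lawS; apply: spread_relation Pf.
apply: contrapT => ftr.
pose H k := sev (@scalar_mx K N.+1) (b k) (h k).1.1.
(* Everything that must lie in the domain of the derivation to start the induction of
   [mdord_subordination] at 0. *)
pose s := svar :: [seq sentry Y ij.1 ij.2 | Y <- G :: codom b ++ codom H,
                   ij <- enum {: 'I_N.+1 * 'I_N.+1}].
have [|P [sigma [sigma0 derf derC derS]]] :=
  @transcendental_der _ (@sdomain K) (@schar0 K) _ (spread_poly K d) f s.
  by move=> P Pf; apply/eqP/negPn/negP => P0; apply: ftr; exists P.
have derc c' : der P (sconst c') 0.
  by have := derC c'%:P; rewrite /spread_poly /= map_polyC /horner_eval hornerC.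
(* [spread_poly] sends ['X] to [svar ^+ d.+1], so only that power is known to be killed;
   characteristic 0 and cancellation of [svar ^+ d] give the claim for [svar]. *)
have dersv : der P svar 0.
  have [|v derv] := derS svar; first by rewrite inE eqxx.
  have derX k : der P (svar ^+ k.+1) (svar ^+ k * v *+ k.+1).
    elim: k => [|k IH]; first by rewrite expr1 mul1r mulr1n.
    rewrite exprS (_ : _ *+ _ = svar * (svar ^+ k * v *+ k.+1) + svar ^+ k.+1 * v).
      exact: derM.
    by rewrite mulrnAr mulrA -exprS -mulrSr.
  have : svar ^+ d * v *+ d.+1 = 0.
    apply: der_inj (derX d) _.
    by have := derC 'X; rewrite /spread_poly /= map_polyX /horner_eval hornerX.
  move=> /schar0 dv0; have v0 : v = 0 by apply: (@svarX_lreg _ d); rewrite mulr0.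
  by rewrite v0 in derv.
have derp r : der P (spoly r) 0.
  elim/poly_ind: r => [|r c' IH]; first by have := derc 0; rewrite !rmorph0.
  have -> : spoly (r * 'X + c'%:P) = spoly r * svar + sconst c'.
    by rewrite rmorphD rmorphM /= spolyX spolyC.
  by have := derD (derM IH dersv) (derc c'); rewrite !mulr0 !addr0.
have mp n (Y : series 'M[K]_N.+1) : poly_entries Y -> mdord P n Y.
  by move=> Yp i j; have [r ->] := Yp i j; exists 0.
have mS Y : Y \in G :: codom b ++ codom H -> mdord P 0 Y.
  move=> YS i j; have [|v derv] := derS (sentry Y i j); last by exists v.
  rewrite inE; apply/orP; right; apply/allpairsP.
  by exists (Y, (i, j)); split => //; rewrite mem_enum.
have Gn n : mdord P n G.
  apply: (@mdord_subordination K N P derc q mu (fun k => (h k).1.1)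
    (fun k => (h k).1.2) (fun k => (h k).2) M0 G M b) => //.
  - by move=> k; have [] := hP k.
  - by move=> k; have [] := hP k.
  - by move=> k; have [] := hP k.
  - by move=> k; have [] := hP k.
  - by move=> k; have [] := hP k.
  - by move=> m; apply: mp.
  - by move=> m k; apply: mp.
  - by apply: mS; rewrite inE eqxx.
  - by move=> k; apply: mS; rewrite inE mem_cat codom_f orbT.
  - by move=> k; apply: mS; rewrite inE mem_cat (codom_f H) !orbT.
(* [sigma] is the derivative of [f], a constant times a sum of entries of [G * e] with [e]
   polynomial; so every power of [svar] divides it. *)
apply/negP: sigma0; rewrite negbK; apply/eqP/sord_eq0 => n.
have [v derv vn] : dord P n (\sum_i sentry (G * e) (idx i) (idx i)).
  by apply: dord_sum => // i; apply: mdordM => //; apply: mp.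
have derv' : der P f (sconst (p.+1%:R^-1) * v).
  by have := derM (derc p.+1%:R^-1) derv; rewrite mulr0 addr0 -fE.
by rewrite (der_inj derf derv'); apply: sordMr.
Qed.

Theorem theorem1 (R : realType) (A : algType R[i]) (phi : {scalar A})
    (hphi : is_state phi) (q p : nat) (hq : (0 < q)%N) (x : 'I_q -> A)
    (hfree : freely_independent phi x)
    (X : algmx A p.+1) (hX : forall i j, nc_polynomials x (X i j))
    (hx : forall i : 'I_q, algebraic_law (law phi (x i))) :
  algebraic_law (law (mxstate phi p) X).
Proof. exact: (algebraic_law_matrix hphi hfree hX hx). Qed.
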